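(* Let $X$ be a d-space, $X_1,X_2\subseteq X$ with $X=\mathrm{Int}(X_1)\cup\mathrm{Int}(X_2)$, the dipaths of $X$ being the finite concatenations of dipaths of $X_1$ and $X_2$, and $X_0=X_1\cap X_2$. For $k=0,1,2$ let $X_k=X_{k,0}\supseteq X_{k,1}\supseteq\dots\supseteq X_{k,n}$ with functors $P_{k,\ell}:\vec\pi_1(X_k,X_{k,\ell-1})\to\vec\pi_1(X_k,X_{k,\ell})$ ($1\le\ell\le n$) be compatible chains of future retracts and past retracts. Put $X_\ell:=X_{1,\ell}\cup X_{2,\ell}$ (so $X_0$-level is $X$). Then for each $\ell$ the square formed by $\vec\pi_1(X_0,X_{0,\ell})$, $\vec\pi_1(X_1,X_{1,\ell})$, $\vec\pi_1(X_2,X_{2,\ell})$, $\vec\pi_1(X,X_\ell)$ and the inclusion-induced functors is a pushout of categories; there is a unique functor $P_\ell:\vec\pi_1(X,X_{\ell-1})\to\vec\pi_1(X,X_\ell)$ with $P_\ell\circ j_{k,\ell-1}=j_{k,\ell}\circ P_{k,\ell}$ for $k=1,2$ (where $j_{k,m}:\vec\pi_1(X_k,X_{k,m})\to\vec\pi_1(X,X_m)$ is induced by inclusion); and $P_\ell$ is a future retract if the $P_{k,\ell}$ are future retracts and a past retract if they are past retracts. Hence the pushout $\vec\pi_1(X)\xrightarrow{P_1}\vec\pi_1(X,X_1)\xrightarrow{P_2}\dots\xrightarrow{P_n}\vec\pi_1(X,X_n)$ is a chain of future retracts and past retracts.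
   Context: A d-space is a topological space with a set of continuous paths $[0,1]\to X$ (dipaths) containing all constant paths, closed under precomposition with continuous non-decreasing maps $[0,1]\to[0,1]$ and under concatenation; subsets carry the dipaths with image in them. The fundamental category $\vec\pi_1(X)$ has objects the points of $X$ and morphisms $a\to b$ the classes of dipaths from $a$ to $b$ modulo the equivalence relation generated by endpoint-fixing directed homotopies; composition is concatenation. For $A\subseteq X$, $\vec\pi_1(X,A)$ is the full subcategory on objects in $A$; inclusions induce functors. For $A\subseteq B\subseteq X$ with inclusion $\iota:\vec\pi_1(X,A)\to\vec\pi_1(X,B)$, a future retract is a functor $P:\vec\pi_1(X,B)\to\vec\pi_1(X,A)$ left adjoint to $\iota$ whose unit satisfies $\eta_a=\mathrm{id}_a$ for $a\in A$; a past retract is a functor $P$ right adjoint to $\iota$ whose counit satisfies $\varepsilon_a=\mathrm{id}_a$ for $a\in A$. Compatible chains: for each $\ell\in\{1,\dots,n\}$ the three functors $P_{0,\ell},P_{1,\ell},P_{2,\ell}$ are either all future retracts or all past retracts; $X_{0,\ell}=X_{1,\ell}\cap X_{2,\ell}$; $X_\ell=X_{1,\ell}\cup X_{2,\ell}$ satisfies $X_\ell=\mathrm{Int}_{X_\ell}(X_{1,\ell})\cup\mathrm{Int}_{X_\ell}(X_{2,\ell})$; with $i_{k,m}:\vec\pi_1(X_0,X_{0,m})\to\vec\pi_1(X_k,X_{k,m})$ the inclusion-induced functors ($k=1,2$), one has $P_{k,\ell}\circ i_{k,\ell-1}=i_{k,\ell}\circ P_{0,\ell}$; and for every $x\in X_{0,\ell-1}$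 the unit (resp. counit) of $P_{0,\ell}$ at $x$ maps to the unit (resp. counit) of $P_{k,\ell}$ at $x$ under the functor $\vec\pi_1(X_0)\to\vec\pi_1(X_k)$, $k=1,2$. *)

(* Defs.v *)
From HB Require Import structures.
From mathcomp Require Import all_boot all_order all_algebra.
From mathcomp Require Import all_classical all_reals topology normedtype.
From Stdlib Require Import Relations.
Import numFieldNormedType.Exports.
Unset Printing Implicit Defensive.
Import Order.TTheory GRing.Theory Num.Theory.
Local Open Scope classical_set_scope.
Local Open Scope ring_scope.

(* Categories, presented with carrier predicates and a setoid equality on     *)
(* arrows ("equality of morphisms").  [cmp f g] is "f then g" (g o f);        *)
(* it is only meaningful when [tgt f = src g].                                *)
Record cat := Cat {
  ob : Type;
  obP : ob -> Prop;
  arr : Type;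
  hom : arr -> Prop;
  src : arr -> ob;
  tgt : arr -> ob;
  idn : ob -> arr;
  cmp : arr -> arr -> arr;
  aeq : arr -> arr -> Prop
}.

Definition IsCat (C : cat) : Prop :=
  (forall f, hom C f -> obP C (src C f) /\ obP C (tgt C f)) /\
  (forall a, obP C a ->
     hom C (idn C a) /\ src C (idn C a) = a /\ tgt C (idn C a) = a) /\
  (forall f g, hom C f -> hom C g -> tgt C f = src C g ->
     hom C (cmp C f g) /\ src C (cmp C f g) = src C f /\
     tgt C (cmp C f g) = tgt C g) /\
  (forall f, hom C f -> aeq C f f) /\
  (forall f g, hom C f -> hom C g -> aeq C f g -> aeq C g f) /\
  (forall f g h, hom C f -> hom C g -> hom C h ->
     aeq C f g -> aeq C g h -> aeq C f h) /\
  (forall f g, hom C f -> hom C g -> aeq C f g ->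
     src C f = src C g /\ tgt C f = tgt C g) /\
  (forall f f' g g', hom C f -> hom C f' -> hom C g -> hom C g' ->
     tgt C f = src C g -> aeq C f f' -> aeq C g g' ->
     aeq C (cmp C f g) (cmp C f' g')) /\
  (forall f, hom C f -> aeq C (cmp C (idn C (src C f)) f) f) /\
  (forall f, hom C f -> aeq C (cmp C f (idn C (tgt C f))) f) /\
  (forall f g h, hom C f -> hom C g -> hom C h ->
     tgt C f = src C g -> tgt C g = src C h ->
     aeq C (cmp C (cmp C f g) h) (cmp C f (cmp C g h))).

Set Implicit Arguments. Unset Strict Implicit.

Record functor (C D : cat) := Functor {
  fob : ob C -> ob D;
  farr : arr C -> arr D
}.

Definition IsFunctor (C D : cat) (F : functor C D) : Prop :=
  (forall a, obP C a -> obP D (fob F a)) /\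
  (forall f, hom C f -> hom D (farr F f) /\
     src D (farr F f) = fob F (src C f) /\ tgt D (farr F f) = fob F (tgt C f)) /\
  (forall f g, hom C f -> hom C g -> aeq C f g -> aeq D (farr F f) (farr F g)) /\
  (forall a, obP C a -> aeq D (farr F (idn C a)) (idn D (fob F a))) /\
  (forall f g, hom C f -> hom C g -> tgt C f = src C g ->
     aeq D (farr F (cmp C f g)) (cmp D (farr F f) (farr F g))).

Definition fcomp (A B C : cat) (F : functor A B) (G : functor B C) : functor A C :=
  Functor (fun a => fob G (fob F a)) (fun f => farr G (farr F f)).

Definition fid (C : cat) : functor C C := Functor (fun a => a) (fun f => f).

Definition feq (C D : cat) (F G : functor C D) : Prop :=
  (forall a, obP C a -> fob F a = fob G a) /\
  (forall f, hom C f -> aeq D (farr F f) (farr G f)).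

Definition IsNat (C D : cat) (F G : functor C D) (eta : ob C -> arr D) : Prop :=
  (forall a, obP C a -> hom D (eta a) /\
     src D (eta a) = fob F a /\ tgt D (eta a) = fob G a) /\
  (forall f, hom C f ->
     aeq D (cmp D (farr F f) (eta (tgt C f))) (cmp D (eta (src C f)) (farr G f))).

Definition IsAdjunction (C D : cat) (L : functor C D) (Rt : functor D C)
    (eta : ob C -> arr C) (eps : ob D -> arr D) : Prop :=
  IsFunctor L /\ IsFunctor Rt /\
  IsNat (fid C) (fcomp L Rt) eta /\ IsNat (fcomp Rt L) (fid D) eps /\
  (forall c, obP C c ->
     aeq D (cmp D (farr L (eta c)) (eps (fob L c))) (idn D (fob L c))) /\
  (forall d, obP D d ->
     aeq C (cmp C (eta (fob Rt d)) (farr Rt (eps d))) (idn C (fob Rt d))).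

Definition IsPushout (C0 C1 C2 C3 : cat)
    (i1 : functor C0 C1) (i2 : functor C0 C2)
    (j1 : functor C1 C3) (j2 : functor C2 C3) : Prop :=
  feq (fcomp i1 j1) (fcomp i2 j2) /\
  forall (E : cat) (G1 : functor C1 E) (G2 : functor C2 E),
    IsCat E -> IsFunctor G1 -> IsFunctor G2 ->
    feq (fcomp i1 G1) (fcomp i2 G2) ->
    exists H : functor C3 E,
      IsFunctor H /\ feq (fcomp j1 H) G1 /\ feq (fcomp j2 H) G2 /\
      forall H' : functor C3 E, IsFunctor H' ->
        feq (fcomp j1 H') G1 -> feq (fcomp j2 H') G2 -> feq H' H.

(* d-spaces.  A path [0,1] -> X is represented by a map R -> X, only its     *)
(* values on [0,1] being relevant.                                           *)
Section DSpace.
Variable R : realType.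

Definition I01 : set R := [set t | 0 <= t <= 1].

Definition ndmap (phi : R -> R) : Prop :=
  {within I01, continuous phi} /\
  (forall t, I01 t -> I01 (phi t)) /\
  (forall s t, I01 s -> I01 t -> s <= t -> phi s <= phi t).

Definition concat (X : Type) (p q : R -> X) : R -> X :=
  fun t => if t <= 2^-1 then p (2 * t) else q (2 * t - 1).

Record dspace (X : topologicalType) := DSpace {
  dpath : set (R -> X);
  dpath_cont : forall p, dpath p -> {within I01, continuous p};
  dpath_restr : forall p q, dpath p -> (forall t, I01 t -> p t = q t) -> dpath q;
  dpath_const : forall x : X, dpath (fun _ => x);
  dpath_reparam : forall p phi, dpath p -> ndmap phi -> dpath (p \o phi);
  dpath_concat : forall p q, dpath p -> dpath q -> p 1 = q 0 -> dpath (concat p q)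
}.

Variables (X : topologicalType) (D : dspace X).

Definition dipath_in (Y : set X) (p : R -> X) : Prop :=
  dpath D p /\ forall t, I01 t -> Y (p t).

(* endpoint-fixing directed homotopy in Y from p to q: a d-map
   H : ↑[0,1] x ↑[0,1] -> Y with H(0,-) = p, H(1,-) = q, H(s,0), H(s,1) fixed *)
Definition dihom (Y : set X) (p q : R -> X) : Prop :=
  exists H : R * R -> X,
    {within I01 `*` I01, continuous H} /\
    (forall phi psi, ndmap phi -> ndmap psi ->
       dipath_in Y (fun t => H (phi t, psi t))) /\
    (forall s, I01 s -> H (s, 0) = p 0 /\ H (s, 1) = p 1) /\
    (forall t, I01 t -> H (0, t) = p t /\ H (1, t) = q t).

Definition pi1 (Y A : set X) : cat :=
  @Cat X A (R -> X) (fun p => dipath_in Y p /\ A (p 0) /\ A (p 1))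
    (fun p => p 0) (fun p => p 1) (fun x => fun _ => x) (@concat X)
    (clos_refl_sym_trans _ (dihom Y)).

Definition pincl (Y A Y' A' : set X) : functor (pi1 Y A) (pi1 Y' A') :=
  @Functor (pi1 Y A) (pi1 Y' A') (fun x => x) (fun p => p).

(* for A ⊆ B ⊆ Y:  P : pi1(Y,B) -> pi1(Y,A) is a future retract, with unit eta
   and counit eps, if it is left adjoint to the inclusion and eta_a = id_a *)
Definition future_retract (Y B A : set X) (P : functor (pi1 Y B) (pi1 Y A))
    (eta : X -> R -> X) (eps : X -> R -> X) : Prop :=
  IsAdjunction (C := pi1 Y B) (D := pi1 Y A) P (pincl Y A Y B) eta eps /\
  forall a, A a -> aeq (pi1 Y B) (eta a) (idn (pi1 Y B) a).

Definition past_retract (Y B A : set X) (P : functor (pi1 Y B) (pi1 Y A))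
    (eta : X -> R -> X) (eps : X -> R -> X) : Prop :=
  IsAdjunction (C := pi1 Y A) (D := pi1 Y B) (pincl Y A Y B) P eta eps /\
  forall a, A a -> aeq (pi1 Y B) (eps a) (idn (pi1 Y B) a).

Definition relint (Z A : set X) : set X :=
  [set x | A x /\ exists U : set X, open U /\ U x /\ U `&` Z `<=` A].

End DSpace.

(* Main.v *)
(** Van Kampen for the whole spaces: a directed path of X can be halved
    repeatedly until every dyadic piece lies in X_1 or in X_2 (Lebesgue
    number), so compatible functors G_1, G_2 extend by composing the values on
    the pieces; refining the subdivision does not change the composite. For a
    directed homotopy, i.e. a d-map from the square, the images of the two
    boundary paths from (0,0) to (1,1) agree: this holds for squares inside
    X_1 or X_2, where monotone paths with common ends are dihomotopic, and it
    is inherited from the four quarters of a square by pasting.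

    From level l-1 to level l: the pushout property at level l-1 yields P_l,
    and the units glue because they agree on the intersection. Naturality of
    the glued unit is checked on paths inside X_1 or X_2, which generate. Since
    P_l and the P_{k,l} restrict to the identity on level l, functors out of
    level l are extended to level l-1 by precomposing with P_{k,l} and then
    restricted back; this gives the pushout property, and likewise generation,
    at level l. *)

Require Import Defs.
From HB Require Import structures.
From mathcomp Require Import all_boot all_order all_algebra.
From mathcomp Require Import all_classical all_reals topology normedtype.
From mathcomp Require Import ring lra.
From Stdlib Require Import Relations.
(* [cat] and [hom] are shadowed by MathComp. *)
Import Defs.
Import numFieldNormedType.Exports.
Import Order.TTheory GRing.Theory Num.Theory.
Local Open Scope classical_set_scope.
Local Open Scope ring_scope.
Set Implicit Arguments. Unset Strict Implicit.

(** * Monotone maps of the interval *)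

(** The obstacle is that a dihomotopy of $X$ does not split into dihomotopies of the pieces: a
    quarter of it has moving endpoints. The invariant is therefore stated for arbitrary directed
    squares, as an equality between the two boundary composites; this form survives cutting into
    quarters. In a dihomotopy two of the four edges are constant, so they contribute identities and
    the equality becomes the one wanted.

    For a retract, one of unit and counit is forced to be an identity, so only the other one has to
    be transported. A boolean records its direction, and the future and past cases then share their
    arguments.

    Two properties travel along the chain together. The pushout property produces functors and
    compares them, but naturality of a given family of arrows is checked path by path, which
    requires that paths of the two parts generate. *)

Lemma comp_within_continuous (S T U : topologicalType) (A : set S) (B : set T)
    (f : S -> T) (g : T -> U) :
  {within A, continuous f} -> (forall x, A x -> B (f x)) ->
  {within B, continuous g} -> {within A, continuous (fun x => g (f x))}.
Proof.
move=> /subspace_continuousP cf AB /subspace_continuousP cg.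
apply/subspace_continuousP => x Ax.
apply: cvg_trans (cg (f x) (AB x Ax)).
apply: (@cvg_comp _ _ _ f g _ (within B (nbhs (f x)))); last exact: cvg_id.
move=> W /= /(cf x Ax); rewrite /= /nbhs /= /within /=.
by apply: filterS => y BW Ay; apply: BW => //; exact: AB.
Qed.

Lemma within_continuous_pair (S T U : topologicalType) (A : set S)
    (f : S -> T) (g : S -> U) :
  {within A, continuous f} -> {within A, continuous g} ->
  {within A, continuous (fun x => (f x, g x))}.
Proof. by move=> cf cg x; apply: cvg_pair; [exact: cf | exact: cg]. Qed.

Section Ndmap.
Context {R : realType}.
Implicit Types (a b phi psi : R -> R).

(** Subdivision is precomposition with [half0] and [half1], the two halves of the interval rescaled
    to $[0,1]$. *)
Definition half0 (t : R) : R := 2^-1 * t.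
Definition half1 (t : R) : R := 2^-1 * (1 + t).

Lemma I010 : I01 (0 : R). Proof. by rewrite /I01 /=; lra. Qed.
Lemma I011 : I01 (1 : R). Proof. by rewrite /I01 /=; lra. Qed.
Hint Resolve I010 I011 : core.

Lemma ndmap_continuous phi : continuous phi ->
  (forall t, I01 t -> I01 (phi t)) ->
  (forall s t, s <= t -> phi s <= phi t) -> ndmap phi.
Proof.
by move=> c h m; split; [exact: continuous_subspaceT | split => // s t _ _; exact: m].
Qed.

Lemma ndmap_affine (c d : R) : 0 <= d -> 0 <= c -> c + d <= 1 ->
  ndmap (fun t => c + d * t).
Proof.
move=> d0 c0 cd1; apply: ndmap_continuous => [x|t|s t st].
- by apply: cvgD; [exact: cvg_cst | apply: cvgM; [exact: cvg_cst | exact: cvg_id]].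
- rewrite /I01 /= => /andP[t0 t1]; have := ler_wpM2l d0 t1; have := mulr_ge0 d0 t0; lra.
- by have := ler_wpM2l d0 st; lra.
Qed.

Lemma ndmap_id : ndmap (fun t : R => t).
Proof. by apply: ndmap_continuous => // x; exact: cvg_id. Qed.

Lemma ndmap_cst (c : R) : I01 c -> ndmap (fun _ : R => c).
Proof. by move=> c01; apply: ndmap_continuous => // x; exact: cvg_cst. Qed.

Lemma ndmap_half0 : ndmap half0.
Proof.
have := @ndmap_affine 0 2^-1; rewrite /half0.
by under eq_fun do rewrite add0r; apply; lra.
Qed.

Lemma ndmap_half1 : ndmap half1.
Proof.
have := @ndmap_affine 2^-1 2^-1; rewrite /half1.
by under [in X in _ -> X]eq_fun do rewrite mulrDr mulr1; apply; lra.
Qed.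

Lemma half00 : half0 0 = 0. Proof. by rewrite /half0 mulr0. Qed.
Lemma half11 : half1 1 = 1. Proof. by rewrite /half1; lra. Qed.
Lemma half10 : half1 0 = half0 1. Proof. by rewrite /half0 /half1; lra. Qed.

Lemma ndmap_I01 phi t : ndmap phi -> I01 t -> I01 (phi t).
Proof. by case=> _ [h _]; exact: h. Qed.

Lemma ndmap_le phi s t : ndmap phi -> I01 s -> I01 t -> s <= t -> phi s <= phi t.
Proof. by case=> _ [_ h]; exact: h. Qed.

Lemma ndmap_comp phi psi : ndmap phi -> ndmap psi -> ndmap (fun t => psi (phi t)).
Proof.
move=> nphi npsi; case: (nphi) (npsi) => [c1 [i1 m1]] [c2 [i2 m2]]; split.
  exact: (comp_within_continuous c1 i1 c2).
split=> [t /i1/i2 //|s t s01 t01 st]; apply: m2; auto.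
Qed.

Lemma ndmap_max phi psi : ndmap phi -> ndmap psi ->
  ndmap (fun t => Order.max (phi t) (psi t)).
Proof.
move=> [c1 [i1 m1]] [c2 [i2 m2]]; split.
  by move=> x; apply: continuous_max; [exact: c1 | exact: c2].
split=> [t t01|s t s01 t01 st].
  have /andP[p0 p1] := i1 _ t01; have /andP[q0 q1] := i2 _ t01.
  by rewrite /I01 /= le_max ge_max p0 p1 q1.
by rewrite ge_max !le_max m1 //= m2 // orbT.
Qed.

(** This is the straight-line homotopy from [a] to [b], evaluated along a homotopy parameter [phi]
    that itself runs forward. *)
Lemma ndmap_convex phi a b : ndmap phi -> ndmap a -> ndmap b ->
  (forall t, I01 t -> a t <= b t) ->
  ndmap (fun t => a t + phi t * (b t - a t)).
Proof.
move=> [c0 [i0 m0]] [c1 [i1 m1]] [c2 [i2 m2]] ab; split.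
  move=> x; apply: (@cvgD _ R^o); first exact: c1.
  apply: (@cvgM R); first exact: c0.
  by apply: (@cvgB _ R^o); [exact: c2 | exact: c1].
split=> [t t01|s t s01 t01 st].
  have := i0 _ t01; have := i1 _ t01; have := i2 _ t01; have := ab _ t01.
  by rewrite /I01 /=; nra.
have := m0 _ _ s01 t01 st; have := m1 _ _ s01 t01 st; have := m2 _ _ s01 t01 st.
have := i0 _ s01; have := i0 _ t01; have := ab _ t01.
rewrite /I01 /= => h1 /andP[h2 h3] /andP[h4 h5] h6 h7 h8.
(* The increment from [s] to [t] is the sum of the three products in [h9], [h10] and [h11]. *)
have h9 : 0 <= (phi t - phi s) * (b t - a t) by apply: mulr_ge0; lra.
have h10 : 0 <= phi s * (b t - b s) by apply: mulr_ge0; lra.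
have h11 : 0 <= (1 - phi s) * (a t - a s) by apply: mulr_ge0; lra.
nra.
Qed.

Lemma ndmap_concat a b : ndmap a -> ndmap b -> a 1 = b 0 -> ndmap (concat a b).
Proof.
move=> na nb ab1.
(* Clamping the two arguments writes the case distinction as one sum, so that continuity and
   monotonicity are inherited termwise. *)
have e t : concat a b t =
    a (Order.min 1 (2 * t)) + b (Order.max 0 (2 * t - 1)) - b 0.
  rewrite /concat; case: (leP t) => h.
    rewrite (_ : Order.min _ _ = 2 * t); last by case: leP; lra.
    rewrite (_ : Order.max _ _ = 0); last by case: leP; lra.
    by rewrite addrK.
  rewrite (_ : Order.min _ _ = 1); last by case: leP; lra.
  rewrite (_ : Order.max _ _ = 2 * t - 1); last by case: leP; lra.
  by rewrite ab1 addrAC subrr add0r.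
have c2 : continuous (fun t : R => 2 * t).
  by move=> x; apply: cvgM; [exact: cvg_cst | exact: cvg_id].
have cl : {within @I01 R, continuous (fun t : R => Order.min 1 (2 * t))}.
  apply: continuous_subspaceT => x; apply: continuous_min; [exact: cvg_cst | exact: c2].
have cr : {within @I01 R, continuous (fun t : R => Order.max 0 (2 * t - 1))}.
  apply: continuous_subspaceT => x.
  apply: (@continuous_max R R (fun=> 0) (fun t => 2 * t - 1)).
    exact: cvg_cst.
  by apply: (@cvgB _ R^o); [exact: c2 | exact: cvg_cst].
have il (t : R) : I01 t -> I01 (Order.min 1 (2 * t)).
  by move=> /andP[t0 t1]; rewrite /I01 /= le_min ge_min ler01 lexx /=; lra.
have ir (t : R) : I01 t -> I01 (Order.max 0 (2 * t - 1)).
  by move=> /andP[t0 t1]; rewrite /I01 /= le_max ge_max ler01 lexx /=; lra.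
case: (na) (nb) => [ca [ia ma]] [cb [ib mb]]; split.
  have c3 : {within @I01 R, continuous (fun t : R =>
      a (Order.min 1 (2 * t)) + b (Order.max 0 (2 * t - 1)) - b 0)}; last first.
    by apply: subspace_eq_continuous c3 => t _; exact: esym (e t).
  move=> x.
  apply: (@cvgB _ R^o); last exact: cvg_cst.
  apply: (@cvgD _ R^o); first exact: (comp_within_continuous cl il ca).
  exact: (comp_within_continuous cr ir cb).
split=> [t t01|s t s01 t01 st].
  rewrite /concat; move: t01; rewrite /I01 /= => t01.
  by case: (leP t) => h; [apply: ia | apply: ib]; rewrite /I01 /=; lra.
rewrite !e lerD2r; apply: lerD.
  by apply: ma; [exact: il | exact: il |
    rewrite le_min !ge_min lexx /=; apply/orP; right; lra].
by apply: mb; [exact: ir | exact: ir |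
  rewrite ge_max !le_max lexx /=; apply/orP; right; lra].
Qed.

End Ndmap.
#[global] Hint Resolve I010 I011 ndmap_id ndmap_half0 ndmap_half1 : core.

(** * Dipaths and directed squares *)

Section Dipaths.
Context {R : realType} {X : topologicalType} (D : dspace R X).
Implicit Types (Y A : set X) (p q r : R -> X) (H : R * R -> X).

(** A d-map from the directed square: a dihomotopy without conditions on its edges. *)
Definition dsquare Y H : Prop :=
  {within @I01 R `*` @I01 R, continuous H} /\
  (forall phi psi, ndmap phi -> ndmap psi ->
     dipath_in D Y (fun t => H (phi t, psi t))).

(** Paths are maps on all of $\mathbb R$; restricting a concatenation to one half recovers the
    factor on $[0,1]$ only. *)
Definition eqI p q : Prop := forall t, I01 t -> p t = q t.

Definition dieq Y : relation (R -> X) := clos_refl_sym_trans _ (dihom D Y).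

Lemma dieq_refl Y p : dieq Y p p. Proof. exact: rst_refl. Qed.

Lemma dieq_sym Y p q : dieq Y p q -> dieq Y q p. Proof. exact: rst_sym. Qed.

Lemma dieq_trans Y p q r : dieq Y p q -> dieq Y q r -> dieq Y p r.
Proof. exact: rst_trans. Qed.

Lemma dipath_eqI Y p q : dipath_in D Y p -> eqI p q -> dipath_in D Y q.
Proof.
move=> [dp Yp] pq; split; first exact: dpath_restr dp pq.
by move=> t t01; rewrite -pq //; exact: Yp.
Qed.

Lemma dipath_sub Y Y' p : Y `<=` Y' -> dipath_in D Y p -> dipath_in D Y' p.
Proof. by move=> YY' [dp Yp]; split=> // t /Yp /YY'. Qed.

Lemma dipath_comp Y p phi : dipath_in D Y p -> ndmap phi ->
  dipath_in D Y (fun t => p (phi t)).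
Proof.
move=> [dp Yp] nphi; split; first exact: (dpath_reparam dp nphi).
by move=> t t01; apply: Yp; exact: ndmap_I01.
Qed.

Lemma dipath_cst Y x : Y x -> dipath_in D Y (fun=> x).
Proof. by move=> Yx; split=> //; exact: dpath_const. Qed.

Lemma dipath_concat Y p q : dipath_in D Y p -> dipath_in D Y q -> p 1 = q 0 ->
  dipath_in D Y (concat p q).
Proof.
move=> [dp Yp] [dq Yq] pq; split; first exact: dpath_concat.
rewrite /I01 /concat /= => t t01; case: leP => h.
  by apply: Yp; rewrite /I01 /=; lra.
by apply: Yq; rewrite /I01 /=; lra.
Qed.

Lemma dpathT p : dpath D p -> dipath_in D setT p. Proof. by []. Qed.

Lemma concat0 (T : Type) (p q : R -> T) : concat p q 0 = p 0.
Proof. by rewrite /concat ifT ?mulr0 //; lra. Qed.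

Lemma concat1 (T : Type) (p q : R -> T) : concat p q 1 = q 1.
Proof. by rewrite /concat ifF; [congr q; lra | apply/negbTE; rewrite -ltNge; lra]. Qed.

Lemma concat_comp (U V : Type) (f : U -> V) (a b : R -> U) :
  (fun t => f (concat a b t)) = concat (fun t => f (a t)) (fun t => f (b t)).
Proof. by apply/funext => t; rewrite /concat; case: ifP. Qed.

Lemma concat_half0 p q : eqI (fun t => concat p q (half0 t)) p.
Proof.
move=> t /andP[t0 t1]; rewrite /concat /half0 ifT; last by lra.
by congr p; lra.
Qed.

Lemma concat_half1 p q : p 1 = q 0 -> eqI (fun t => concat p q (half1 t)) q.
Proof.
move=> pq t /andP[t0 t1]; rewrite /concat /half1; case: leP => h; last by congr q; lra.
have -> : t = 0 by lra.
by rewrite -pq; congr p; lra.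
Qed.

Lemma concat_halves p : concat (fun t => p (half0 t)) (fun t => p (half1 t)) = p.
Proof.
by apply/funext => t; rewrite /concat /half0 /half1; case: ifP => _; congr p; lra.
Qed.

Lemma eqI_concat p p' q q' : eqI p p' -> eqI q q' -> eqI (concat p q) (concat p' q').
Proof.
move=> pp qq t /andP[t0 t1]; rewrite /concat; case: leP => h.
  by apply: pp; rewrite /I01 /=; lra.
by apply: qq; rewrite /I01 /=; lra.
Qed.

Lemma dsquare_path Y p : dipath_in D Y p -> dsquare Y (fun st => p st.2).
Proof.
move=> dp; split; last by move=> phi psi _ npsi; exact: dipath_comp.
apply: (@comp_within_continuous (R * R)%type R _ (@I01 R `*` @I01 R) (@I01 R) (@snd R R) p).
- by apply: continuous_subspaceT => x; exact: cvg_snd.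
- by move=> x [].
- exact: (dpath_cont dp.1).
Qed.

Lemma dsquare_sub Y Y' H : Y `<=` Y' -> dsquare Y H -> dsquare Y' H.
Proof.
move=> YY' [cH dH]; split=> // phi psi n1 n2.
by apply: dipath_sub YY' _; exact: dH.
Qed.

Lemma dsquare_in Y H : dsquare setT H ->
  (forall s t, I01 s -> I01 t -> Y (H (s, t))) -> dsquare Y H.
Proof.
move=> [cH dH] YH; split=> // phi psi n1 n2; split; first exact: (dH _ _ n1 n2).1.
by move=> t t01; apply: YH; exact: ndmap_I01.
Qed.

Lemma dsquare_comp Y H a b : dsquare Y H -> ndmap a -> ndmap b ->
  dsquare Y (fun st => H (a st.1, b st.2)).
Proof.
move=> [cH dH] na nb; split; last first.
  by move=> phi psi n1 n2 /=; apply: dH; exact: ndmap_comp.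
apply: (@comp_within_continuous (R * R)%type (R * R)%type _ _ (@I01 R `*` @I01 R)
  (fun st : R * R => (a st.1, b st.2)) H) => //; last first.
  by move=> x [? ?]; split; exact: ndmap_I01.
apply: within_continuous_pair.
  apply: (@comp_within_continuous (R * R)%type R _ (@I01 R `*` @I01 R) (@I01 R) (@fst R R) a).
  - by apply: continuous_subspaceT => x; exact: cvg_fst.
  - by move=> x [].
  - by case: na.
apply: (@comp_within_continuous (R * R)%type R _ (@I01 R `*` @I01 R) (@I01 R) (@snd R R) b).
- by apply: continuous_subspaceT => x; exact: cvg_snd.
- by move=> x [].
- by case: nb.
Qed.

Lemma dihom_dieq Y p q : dihom D Y p q -> dieq Y p q.
Proof. exact: rst_step. Qed.

Lemma dihom_ends Y p q : dihom D Y p q ->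
  [/\ dipath_in D Y p, dipath_in D Y q, p 0 = q 0 & p 1 = q 1].
Proof.
move=> [H [cH [dH [e1 e2]]]]; split.
- apply: (dipath_eqI (dH _ _ (ndmap_cst I010) (@ndmap_id R))) => t t01.
  by case: (e2 t t01).
- apply: (dipath_eqI (dH _ _ (ndmap_cst I011) (@ndmap_id R))) => t t01.
  by case: (e2 t t01).
- by rewrite -(e2 _ I010).2 (e1 _ I011).1.
- by rewrite -(e2 _ I011).2 (e1 _ I011).2.
Qed.

Lemma dieq_ends Y p q : dieq Y p q -> p 0 = q 0 /\ p 1 = q 1.
Proof.
elim=> [x y /dihom_ends[]//|//|x y _ [-> ->]//|x y z _ [-> ->] _ [-> ->]//].
Qed.

Lemma dieq_dipath Y p q : dieq Y p q -> dipath_in D Y p <-> dipath_in D Y q.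
Proof.
elim=> [x y /dihom_ends[]//|//|x y _ [? ?]|x y z _ [h1 h2] _ [h3 h4]]; split; auto.
Qed.

Lemma dieq_sub Y Y' p q : Y `<=` Y' -> dieq Y p q -> dieq Y' p q.
Proof.
move=> YY'; elim=> [x y [H [cH [dH e]]]|x|x y _|x y z _ xy _ yz].
- apply: rst_step; exists H; split=> //; split=> // phi psi n1 n2.
  by apply: dipath_sub YY' _; exact: dH.
- exact: rst_refl.
- exact: rst_sym.
- exact: rst_trans xy yz.
Qed.

Lemma dieq_eqI Y p q : dipath_in D Y p -> eqI p q -> dieq Y p q.
Proof.
move=> dp pq; apply: rst_step; exists (fun st => p st.2).
have [cH dH] := dsquare_path dp.
by split=> //; split=> //; split=> // t t01; split=> //; exact: pq.
Qed.

(** The straight-line homotopy between the two monotone maps into the square; the pointwise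
    inequalities make it non-decreasing in the homotopy parameter too. *)
Lemma dihom_convex Y H a a' b b' : dsquare Y H ->
  ndmap a -> ndmap a' -> ndmap b -> ndmap b' ->
  a 0 = a' 0 -> a 1 = a' 1 -> b 0 = b' 0 -> b 1 = b' 1 ->
  (forall t, I01 t -> a t <= a' t) -> (forall t, I01 t -> b t <= b' t) ->
  dihom D Y (fun t => H (a t, b t)) (fun t => H (a' t, b' t)).
Proof.
move=> [cH dH] na na' nb nb' a0 a1 b0 b1 aa' bb'.
pose cvx (f g : R -> R) (st : R * R) : R := f st.2 + st.1 * (g st.2 - f st.2).
have cvxc f g : ndmap f -> ndmap g ->
    {within @I01 R `*` @I01 R, continuous (cvx f g)}.
  move=> [cf _] [cg _].
  have c2 h : {within @I01 R, continuous h} ->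
      {within @I01 R `*` @I01 R, continuous (fun st : R * R => h st.2 : R)}.
    move=> ch; apply: (@comp_within_continuous (R * R)%type R _
      (@I01 R `*` @I01 R) (@I01 R) (@snd R R) h) => //.
      by apply: continuous_subspaceT => x; exact: cvg_snd.
    by move=> x [].
  move=> x; apply: (@cvgD _ R^o); first exact: (c2 f).
  apply: (@cvgM R).
    have : {within @I01 R `*` @I01 R, continuous (@fst R R)}.
      by apply: continuous_subspaceT => y; exact: cvg_fst.
    exact.
  by apply: (@cvgB _ R^o); [exact: (c2 g) | exact: (c2 f)].
exists (fun st => H (cvx a a' st, cvx b b' st)); split.
  apply: (@comp_within_continuous (R * R)%type (R * R)%type _ _ (@I01 R `*` @I01 R)
    (fun st : R * R => (cvx a a' st, cvx b b' st)) H) => //.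
    by apply: within_continuous_pair; exact: cvxc.
  move=> [s t] [/= s01 t01].
  have h f g : ndmap f -> ndmap g -> (forall u, I01 u -> f u <= g u) ->
      I01 (cvx f g (s, t)).
    move=> nf ng fg; exact: (ndmap_I01 (ndmap_convex (ndmap_cst s01) nf ng fg) t01).
  by split; exact: h.
split.
  move=> phi psi n1 n2; apply: (dH (fun t => cvx a a' (phi t, psi t))
    (fun t => cvx b b' (phi t, psi t))).
    by apply: ndmap_convex => //; [exact: ndmap_comp|exact: ndmap_comp|
      move=> t t01; apply: aa'; exact: ndmap_I01].
  by apply: ndmap_convex => //; [exact: ndmap_comp|exact: ndmap_comp|
    move=> t t01; apply: bb'; exact: ndmap_I01].
rewrite /cvx; split=> [s s01|t t01] /=.
  by rewrite a0 a1 b0 b1 !subrr !mulr0 !addr0.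
have e (x y : R) : x + 1 * (y - x) = y by lra.
by rewrite !mul0r !addr0 !e.
Qed.

(* A directed homotopy can only move forward, so two monotone paths of the
   square are compared through their pointwise maximum. *)
Lemma dsquare_dieq Y H a a' b b' : dsquare Y H ->
  ndmap a -> ndmap a' -> ndmap b -> ndmap b' ->
  a 0 = a' 0 -> a 1 = a' 1 -> b 0 = b' 0 -> b 1 = b' 1 ->
  dieq Y (fun t => H (a t, b t)) (fun t => H (a' t, b' t)).
Proof.
move=> sH na na' nb nb' a0 a1 b0 b1.
pose ma t := Order.max (a t) (a' t); pose mb t := Order.max (b t) (b' t).
have nma : ndmap ma by exact: ndmap_max.
have nmb : ndmap mb by exact: ndmap_max.
apply: (dieq_trans (q := fun t => H (ma t, mb t))); [|apply: dieq_sym];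
  apply/dihom_dieq/dihom_convex => //; rewrite /ma /mb
    ?a0 ?a1 ?b0 ?b1 ?maxxx // => t _; by rewrite le_max lexx ?orbT.
Qed.

Lemma reparam_dieq Y p a a' : dipath_in D Y p -> ndmap a -> ndmap a' ->
  a 0 = a' 0 -> a 1 = a' 1 ->
  dieq Y (fun t => p (a t)) (fun t => p (a' t)).
Proof.
by move=> dp na na' a0 a1; have := @dsquare_dieq Y _ a a' a a' (dsquare_path dp); apply.
Qed.

Lemma concat_cst_l Y p : dipath_in D Y p -> dieq Y (concat (fun=> p 0) p) p.
Proof.
move=> dp; rewrite -(concat_comp p (fun=> 0) (fun t => t)).
apply: (@reparam_dieq Y p _ (fun t => t)) => //; rewrite ?concat0 ?concat1 //.
by apply: ndmap_concat => //; exact: ndmap_cst.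
Qed.

Lemma concat_cst_r Y p : dipath_in D Y p -> dieq Y (concat p (fun=> p 1)) p.
Proof.
move=> dp; rewrite -(concat_comp p (fun t => t) (fun=> 1)).
apply: (@reparam_dieq Y p _ (fun t => t)) => //; rewrite ?concat0 ?concat1 //.
by apply: ndmap_concat => //; exact: ndmap_cst.
Qed.

Lemma concatA Y p q r :
  dipath_in D Y p -> dipath_in D Y q -> dipath_in D Y r ->
  p 1 = q 0 -> q 1 = r 0 ->
  dieq Y (concat (concat p q) r) (concat p (concat q r)).
Proof.
move=> dp dq dr pq qr; set u := concat (concat p q) r.
have du : dipath_in D Y u.
  by apply: dipath_concat => //; [exact: dipath_concat | rewrite concat1].
(* The piecewise linear map sending $0,1/2,3/4,1$ to $0,1/4,1/2,1$: it turns one bracketing into the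
   other. *)
pose th := concat (fun t : R => half0 (half0 t))
  (concat (fun t => half0 (half1 t)) half1).
have nth : ndmap th.
  apply: ndmap_concat; first exact: ndmap_comp.
    by apply: ndmap_concat => //; [exact: ndmap_comp | rewrite half11 half10].
  by rewrite concat0 half10.
apply: (@dieq_trans Y _ (fun t => u (th t))).
  apply: (@reparam_dieq Y u (fun t => t)) => //.
    by rewrite /th concat0 !half00.
  by rewrite /th !concat1 half11.
apply: dieq_eqI; first exact: dipath_comp.
rewrite /th concat_comp; apply: eqI_concat.
  move=> t t01; rewrite /u concat_half0 ?concat_half0 //; exact: ndmap_I01.
rewrite concat_comp; apply: eqI_concat.
  move=> t t01; rewrite /u concat_half0 ?concat_half1 //; exact: ndmap_I01.
by apply: concat_half1; rewrite concat1.
Qed.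

(** The axiom of a d-space concatenates at $1/2$ only; a junction at an arbitrary time [c] is moved
    there by a reparametrisation. If [c] is an end of the interval, one piece is already the whole
    path. *)
Lemma dpath_glue (c : R) r : I01 c ->
  dpath D (fun t => r (c * t)) -> dpath D (fun t => r (c + (1 - c) * t)) ->
  dpath D r.
Proof.
move=> /andP[c0 c1] d1 d2.
have [ce0|cn0] := eqVneq c 0.
  apply: dpath_restr d2 _ => t _; congr r; rewrite ce0; lra.
have [ce1|cn1] := eqVneq c 1.
  apply: dpath_restr d1 _ => t _; congr r; rewrite ce1; lra.
have {cn0}c0 : 0 < c by rewrite lt_neqAle eq_sym cn0.
have {cn1}c1 : 0 < 1 - c by rewrite subr_gt0 lt_neqAle cn1.
(* The piecewise linear map with $0\mapsto 0$, $c\mapsto 1/2$, $1\mapsto 1$. *)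
pose th (u : R) := Order.min u c / (2 * c) + Order.max (u - c) 0 / (2 * (1 - c)).
have i1 : 0 < (2 * c)^-1 by rewrite invr_gt0; lra.
have i2 : 0 < (2 * (1 - c))^-1 by rewrite invr_gt0; lra.
have th1 (u : R) : u <= c -> th u = u / (2 * c).
  move=> h; rewrite /th (_ : Order.min u c = u); last by case: leP; lra.
  by rewrite (_ : Order.max _ _ = 0) ?mul0r ?addr0 //; case: leP; lra.
have th2 (u : R) : c < u -> th u = 2^-1 + (u - c) / (2 * (1 - c)).
  move=> h; rewrite /th (_ : Order.min u c = c); last by case: leP; lra.
  rewrite (_ : Order.max _ _ = u - c); last by case: leP; lra.
  by congr (_ + _); field; lra.
have thm (s t : R) : s <= t -> th s <= th t.
  move=> st; apply: lerD; rewrite ler_wpM2r ?(ltW i1) ?(ltW i2) //.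
    by rewrite le_min !ge_min lexx st orbT.
  by rewrite ge_max !le_max lexx orbT lerD2r st.
have th0 : th 0 = 0 by rewrite th1 ?mul0r // ltW.
have th11 : th 1 = 1 by rewrite th2; [field; lra | lra].
have nth : ndmap th.
  apply: ndmap_continuous => // [x|t /andP[t0 t1]]; last first.
    apply/andP; split; first by rewrite -[leLHS]th0; exact: thm.
    by rewrite -[leRHS]th11; exact: thm.
  apply: cvgD; apply: (@cvgM R); try exact: cvg_cst.
    by apply: (@continuous_min R R id (fun=> c)); [exact: cvg_id | exact: cvg_cst].
  apply: (@continuous_max R R (fun u => u - c) (fun=> 0)); last exact: cvg_cst.
  by apply: (@cvgB _ R^o); [exact: cvg_id | exact: cvg_cst].
have dc : dpath D (concat (fun t => r (c * t)) (fun t => r (c + (1 - c) * t))).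
  by apply: dpath_concat => //; congr r; lra.
apply: dpath_restr (dpath_reparam dc nth) _ => u u01.
rewrite /= /concat; case: (leP u c) => h.
  have hu : u / (2 * c) <= 2^-1.
    by rewrite ler_pdivrMr; lra.
  by rewrite th1 // hu; congr r; field; lra.
have hu : 0 < (u - c) / (2 * (1 - c)) by rewrite mulr_gt0 // subr_gt0.
rewrite th2 // ifF; last by apply/negbTE; rewrite -ltNge ltrDl.
by congr r; field; lra.
Qed.

Lemma dsquare_concat Y H1 H2 : dsquare Y H1 -> dsquare Y H2 ->
  (forall s, I01 s -> H1 (s, 1) = H2 (s, 0)) ->
  dsquare Y (fun st => concat (fun t => H1 (st.1, t)) (fun t => H2 (st.1, t)) st.2).
Proof.
move=> [c1 d1] [c2 d2] e12.
set K := (K in dsquare Y K).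
have K1 s t : t <= 2^-1 -> K (s, t) = H1 (s, 2 * t).
  by move=> h; rewrite /K /concat /= h.
have K2 s t : I01 s -> 2^-1 <= t -> K (s, t) = H2 (s, 2 * t - 1).
  move=> s01 h; rewrite /K /concat /=; case: leP => h' //.
  have -> : t = 2^-1 by lra.
  have -> : 2 * 2^-1 = 1 :> R by lra.
  by rewrite subrr e12.
split.
  pose L := @I01 R `*` [set t : R | 0 <= t <= 2^-1].
  pose U := @I01 R `*` [set t : R | 2^-1 <= t <= 1].
  have -> : @I01 R `*` @I01 R = L `|` U.
    apply/seteqP; split=> [[s t]|[s t]]; rewrite /L /U /I01 /=.
      by move=> [s01 t01]; have [h|h] := leP t 2^-1; [left|right]; split=> //; lra.
    by move=> [[s01 t01]|[s01 t01]]; split=> //; lra.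
  have cl (a b : R) : closed (@I01 R `*` [set t : R | a <= t <= b]).
    have ci (c d : R) : closed [set t : R | c <= t <= d].
      have -> : [set t : R | c <= t <= d] = `[c, d]%classic by rewrite set_itvE.
      exact: itv_closed.
    by apply: closedI; apply: preimage_closed (ci _ _) => x _;
      [exact: cvg_fst | exact: cvg_snd].
  have csub (A : set (R * R)) (f : R -> R) H :
      {within @I01 R `*` @I01 R, continuous H} -> continuous f ->
      (forall st, A st -> I01 st.1 /\ I01 (f st.2)) ->
      {within A, continuous (fun st => H (st.1, f st.2))}.
    move=> cH cf Af.
    apply: (@comp_within_continuous (R * R)%type (R * R)%type _ _ (@I01 R `*` @I01 R)
      (fun st : R * R => (st.1, f st.2)) H) => //.
    apply: within_continuous_pair; apply: continuous_subspaceT => x; first exact: cvg_fst.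
    by apply: (@continuous_comp _ _ _ (@snd R R) f); [exact: cvg_snd | exact: cf].
  have cm : continuous (fun t : R => 2 * t).
    by move=> x; apply: cvgM; [exact: cvg_cst | exact: cvg_id].
  apply: withinU_continuous; try exact: cl.
    have h : {within L, continuous (fun st => H1 (st.1, 2 * st.2))}.
      apply: csub => // -[s t] [/= s01 t01]; split=> //; rewrite /I01 /=; lra.
    apply: subspace_eq_continuous h => -[s t]; rewrite inE => -[/= s01 /andP[t0 t1]].
    exact/esym/K1.
  have h : {within U, continuous (fun st => H2 (st.1, 2 * st.2 - 1))}.
    apply: (csub _ (fun t => 2 * t - 1)) => //.
      by move=> x; apply: (@cvgB _ R^o); [exact: cm | exact: cvg_cst].
    move=> -[s t] [/= s01 t01]; split=> //; rewrite /I01 /=; lra.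
  apply: subspace_eq_continuous h => -[s t]; rewrite inE => -[/= s01 /andP[t0 t1]].
  exact/esym/K2.
move=> phi psi nphi npsi.
have YK s t : I01 s -> I01 t -> Y (K (s, t)).
  move=> s01 /andP[t0 t1]; have [h|h] := leP t 2^-1.
    rewrite K1 //; have t2 : I01 (2 * t) by rewrite /I01 /=; lra.
    exact: ((d1 _ _ (ndmap_cst s01) (ndmap_cst t2)).2 0).
  rewrite K2 ?(ltW h) //; have t2 : I01 (2 * t - 1) by rewrite /I01 /=; lra.
  exact: ((d2 _ _ (ndmap_cst s01) (ndmap_cst t2)).2 0).
split; last by move=> t t01; apply: YK; exact: ndmap_I01.
have low a b : ndmap a -> ndmap b -> (forall t, I01 t -> b t <= 2^-1) ->
    dpath D (fun t => K (a t, b t)).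
  move=> na nb hb.
  have nb2 : ndmap (fun t => 2 * b t).
    split; first by move=> x; apply: (@cvgM R); [exact: cvg_cst | exact: nb.1].
    split=> [t t01|s t s01 t01 st].
      by have := ndmap_I01 nb t01; have := hb t t01; rewrite /I01 /=; lra.
    by have := ndmap_le nb s01 t01 st; lra.
  by apply: dpath_restr (d1 _ _ na nb2).1 _ => t t01; rewrite K1 // hb.
have high a b : ndmap a -> ndmap b -> (forall t, I01 t -> 2^-1 <= b t) ->
    dpath D (fun t => K (a t, b t)).
  move=> na nb hb.
  have nb2 : ndmap (fun t => 2 * b t - 1).
    split.
      move=> x; apply: (@cvgB _ R^o); last exact: cvg_cst.
      by apply: (@cvgM R); [exact: cvg_cst | exact: nb.1].
    split=> [t t01|s t s01 t01 st].
      by have := ndmap_I01 nb t01; have := hb t t01; rewrite /I01 /=; lra.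
    by have := ndmap_le nb s01 t01 st; lra.
  apply: dpath_restr (d2 _ _ na nb2).1 _ => t t01.
  by rewrite K2 ?hb //; exact: ndmap_I01.
(* If the monotone [psi] stays on one side of the seam $1/2$, one of the two squares suffices.
   Otherwise the intermediate value theorem gives a time [c] on the seam, and the pieces before and
   after [c] are glued. *)
have [h1|h1] := leP (psi 1) 2^-1.
  apply: low => // t /[dup] t01 /andP[t0 t1].
  exact: le_trans (ndmap_le npsi t01 I011 t1) h1.
have [h0|h0] := leP 2^-1 (psi 0).
  apply: high => // t /[dup] t01 /andP[t0 t1].
  exact: le_trans h0 (ndmap_le npsi I010 t01 t0).
have [c c01 ec] : exists2 c, I01 c & psi c = 2^-1.
  have [||c] := @IVT R psi 0 1 2^-1 ler01.
  - have -> : `[0, 1]%classic = @I01 R by rewrite set_itvE.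
    exact: npsi.1.
  - by rewrite ge_min le_max (ltW h0) (ltW h1) orbT.
  by rewrite in_itv /= => c01 ec; exists c.
have /andP[c0 c1'] := c01.
have nl : ndmap (fun t : R => c * t).
  have := @ndmap_affine R 0 c.
  by under eq_fun do rewrite add0r; apply; lra.
have nh : ndmap (fun t : R => c + (1 - c) * t) by apply: ndmap_affine; lra.
apply: (@dpath_glue c) => //.
  apply: low; try exact: ndmap_comp.
  move=> t t01; rewrite -ec; apply: ndmap_le => //; first exact: ndmap_I01 nl t01.
  by case/andP: t01 => t0 t1; rewrite ler_piMr.
apply: high; try exact: (ndmap_comp nh).
move=> t t01; rewrite -ec; apply: ndmap_le => //; first exact: ndmap_I01 nh t01.
by case/andP: t01 => t0 t1; rewrite lerDl mulr_ge0 // subr_ge0.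
Qed.

Lemma dihom_concat Y p p' q q' : dihom D Y p p' -> dihom D Y q q' -> p 1 = q 0 ->
  dihom D Y (concat p q) (concat p' q').
Proof.
move=> [H1 [c1 [d1 [e1 f1]]]] [H2 [c2 [d2 [e2 f2]]]] pq.
exists (fun st => concat (fun t => H1 (st.1, t)) (fun t => H2 (st.1, t)) st.2).
have [//|//|s s01|cK dK] := @dsquare_concat Y H1 H2.
  by rewrite (e1 s s01).2 (e2 s s01).1.
split=> //; split=> //; split=> [s s01|t t01] /=.
  by rewrite !concat0 !concat1 (e1 s s01).1 (e2 s s01).2.
split; (apply: eqI_concat t01 => u u01; [by case: (f1 u u01) | by case: (f2 u u01)]).
Qed.

Lemma dihom_refl Y p : dipath_in D Y p -> dihom D Y p p.
Proof.
move=> dp; exists (fun st => p st.2); have [cH dH] := dsquare_path dp.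
by split=> //; split.
Qed.

(** One factor is changed at a time, because the two chains of dihomotopies may have different
    lengths. *)
Lemma dieq_concat Y p p' q q' : dipath_in D Y p' -> dipath_in D Y q ->
  dieq Y p p' -> dieq Y q q' -> p 1 = q 0 ->
  dieq Y (concat p q) (concat p' q').
Proof.
move=> dp' dq pp' qq' pq; have pq' : p' 1 = q 0 by rewrite -(dieq_ends pp').2.
apply: (@dieq_trans Y _ (concat p' q)).
  elim: pp' pq {dp' pq'} => [x y xy|x|x y xy IH|x y z xy IH1 yz IH2] e.
  - by apply/dihom_dieq/dihom_concat => //; exact: dihom_refl.
  - exact: dieq_refl.
  - by apply/dieq_sym/IH; rewrite (dieq_ends xy).2.
  - by apply: dieq_trans (IH1 e) (IH2 _); rewrite -(dieq_ends xy).2.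
elim: qq' pq' {dq pq} => [x y xy|x|x y xy IH|x y z xy IH1 yz IH2] e.
- by apply/dihom_dieq/dihom_concat => //; exact: dihom_refl.
- exact: dieq_refl.
- by apply/dieq_sym/IH; rewrite (dieq_ends xy).1.
- by apply: dieq_trans (IH1 e) (IH2 _); rewrite -(dieq_ends xy).1.
Qed.

Lemma pi1_IsCat Y A : A `<=` Y -> IsCat (pi1 D Y A).
Proof.
move=> AY; split=> [f [_ //]|]; split=> [a Aa|].
  by split=> //; split=> //; apply: dipath_cst; exact: AY.
split=> [f g [df [f0 f1]] [dg [g0 g1]] /= fg|].
  by rewrite concat0 concat1; split=> //; split; first exact: dipath_concat.
split=> [f _|]; first exact: dieq_refl.
split=> [f g _ _|]; first exact: dieq_sym.
split=> [f g h _ _ _|]; first exact: dieq_trans.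
split=> [f g _ _|]; first exact: dieq_ends.
split=> [f f' g g' [df _] [df' _] [dg _] [dg' _] fg ff' gg'|].
  exact: dieq_concat.
split=> [f [df _]|]; first exact: concat_cst_l.
split=> [f [df _]|]; first exact: concat_cst_r.
by move=> f g h [df _] [dg _] [dh _]; exact: concatA.
Qed.

Lemma pincl_IsFunctor Y A Y' A' : Y `<=` Y' -> A `<=` A' ->
  IsFunctor (pincl D Y A Y' A').
Proof.
move=> YY' AA'; split=> [a /AA' //|]; split=> [f [df [f0 f1]]|].
  split=> //; split; first exact: dipath_sub df.
  by split; exact: AA'.
split=> [f g _ _|]; first exact: dieq_sub.
by split=> [a _|f g _ _ _]; exact: dieq_refl.
Qed.

End Dipaths.

(** * Categories with a setoid of arrows *)

Section Categories.
Context {C : cat} (isC : IsCat C).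
Implicit Types (f g h k : arr C) (a b c d : ob C).

Definition is_arr f a b : Prop := [/\ hom C f, src C f = a & tgt C f = b].

(* Arrow equality restricted to genuine arrows, so that symmetry, transitivity
   and congruence need no well-formedness side conditions. *)
Definition heq f g : Prop := [/\ hom C f, hom C g & aeq C f g].

Lemma heq_refl f : hom C f -> heq f f.
Proof. by case: isC => _ [_ [_ [h _]]] hf; split=> //; exact: h. Qed.

Lemma heq_sym f g : heq f g -> heq g f.
Proof. by case: isC => _ [_ [_ [_ [h _]]]] [hf hg fg]; split=> //; exact: h. Qed.

Lemma heq_trans f g h : heq f g -> heq g h -> heq f h.
Proof.
case: isC => _ [_ [_ [_ [_ [tr _]]]]] [hf hg fg] [_ hh gh]; split=> //.
exact: (tr _ _ _ hf hg hh).
Qed.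

Lemma heq_ends f g : heq f g -> src C f = src C g /\ tgt C f = tgt C g.
Proof. by case: isC => _ [_ [_ [_ [_ [_ [h _]]]]]] [hf hg fg]; exact: h. Qed.

Lemma is_arr_cmp f g a b c : is_arr f a b -> is_arr g b c -> is_arr (cmp C f g) a c.
Proof.
case: isC => _ [_ [h _]] [hf <- fb] [hg gb <-].
by have [|? [? ?]] := h f g hf hg; rewrite ?fb ?gb.
Qed.

Lemma is_arr_idn a : obP C a -> is_arr (idn C a) a a.
Proof. by case: isC => _ [h _] /h [? [? ?]]. Qed.

Lemma heq_is_arr f g a b : heq f g -> is_arr f a b -> is_arr g a b.
Proof.
move=> fg [_ fa fb]; have [e1 e2] := heq_ends fg.
by case: fg => _ ? _; split; rewrite -?e1 -?e2.
Qed.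

Lemma heq_cmp f f' g g' : heq f f' -> heq g g' -> tgt C f = src C g ->
  heq (cmp C f g) (cmp C f' g').
Proof.
move=> ff gg e; have [e1 e2] := heq_ends ff; have [e3 e4] := heq_ends gg.
case: isC => _ [_ [hc [_ [_ [_ [_ [h _]]]]]]].
case: ff gg => hf hf' ff [hg hg' gg]; split.
- by case: (hc f g hf hg e).
- by case: (hc f' g' hf' hg'); rewrite -?e2 -?e3.
- exact: h.
Qed.

Lemma heq_idl f : hom C f -> heq (cmp C (idn C (src C f)) f) f.
Proof.
move=> hf; case: isC => ho [hi [hc [_ [_ [_ [_ [_ [hl _]]]]]]]].
have [? [? e]] := hi _ (ho f hf).1; split=> //; last exact: hl.
by case: (hc _ f _ hf e).
Qed.

Lemma heq_idr f : hom C f -> heq (cmp C f (idn C (tgt C f))) f.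
Proof.
move=> hf; case: isC => ho [hi [hc [_ [_ [_ [_ [_ [_ [hr _]]]]]]]]].
have [? [e ?]] := hi _ (ho f hf).2; split=> //; last exact: hr.
by case: (hc f _ hf _ (esym e)).
Qed.

Lemma heqA f g h a b c d : is_arr f a b -> is_arr g b c -> is_arr h c d ->
  heq (cmp C (cmp C f g) h) (cmp C f (cmp C g h)).
Proof.
move=> af ag ah.
have [h1 _ _] := is_arr_cmp (is_arr_cmp af ag) ah.
have [h2 _ _] := is_arr_cmp af (is_arr_cmp ag ah).
split=> //; case: isC => _ [_ [_ [_ [_ [_ [_ [_ [_ [_ hA]]]]]]]]].
by case: af ag ah => ? _ fb [? gb gc] [? hh _]; apply: hA => //; rewrite ?fb ?gb ?gc ?hh.
Qed.

(** Two adjacent commuting squares form a commuting rectangle. This serves both for the quarters of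
    a directed square and for naturality at a composite. *)
Lemma paste_squares f1 f2 g g' h k1 k2 a b c a' b' c' :
  is_arr f1 a b -> is_arr f2 b c -> is_arr g b b' -> is_arr g' c c' ->
  is_arr h a a' -> is_arr k1 a' b' -> is_arr k2 b' c' ->
  heq (cmp C f1 g) (cmp C h k1) -> heq (cmp C f2 g') (cmp C g k2) ->
  heq (cmp C (cmp C f1 f2) g') (cmp C h (cmp C k1 k2)).
Proof.
move=> af1 af2 ag ag' ah ak1 ak2 s1 s2.
have r f u v : is_arr f u v -> heq f f by case=> hf _ _; exact: heq_refl.
have e f u v : is_arr f u v -> tgt C f = v by case.
have e' f u v : is_arr f u v -> src C f = u by case.
apply: heq_trans (heqA af1 af2 ag') _.
apply: heq_trans (heq_cmp (r _ _ _ af1) s2 _) _.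
  by rewrite (e _ _ _ af1) (e' _ _ _ (is_arr_cmp af2 ag')).
apply: heq_trans (heq_sym (heqA af1 ag ak2)) _.
apply: heq_trans (heq_cmp s1 (r _ _ _ ak2) _) _.
  by rewrite (e' _ _ _ ak2) (e _ _ _ (is_arr_cmp af1 ag)).
exact: heqA ah ak1 ak2.
Qed.

End Categories.

(** * Lebesgue numbers and induction by subdivision *)

Section Lebesgue.
Context {R : realType} {X : topologicalType} (D : dspace R X) (Y : bool -> set X).
Hypothesis Ycover : forall x, exists b, interior (Y b) x.

Lemma lebesgue_number (T : pseudoMetricType R) (K : set T) (f : T -> X) :
  compact K -> {within K, continuous f} ->
  exists2 e : R, 0 < e &
    forall x, K x -> exists b, forall y, K y -> ball x e y -> Y b (f y).
Proof.
move=> /compact_near_coveringP/near_covering_withinP cK /subspace_continuousP cf.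
(* By the near-covering form of compactness it is enough to obtain [Q] for all small [e] and all
   points near a given one; a common [e] follows. *)
pose Q (e : R) (x : T) := exists b, forall y, K y -> ball x e y -> Y b (f y).
have : \forall e \near 0^'+, K `<=` Q e.
  apply: cK => x Kx; have [b bx] := Ycover (f x).
  have : within K (nbhs x) (f @^-1` Y b) by exact: cf.
  rewrite /within /= => /nbhs_ballP[d /= d0 hd].
  (* Half of [d] is spent on moving the centre from [x] to [x'], the other half on the ball around
     [x']. *)
  exists (ball x (d / 2), [set e | e < d / 2]) => /=.
    split; first by apply: nbhsx_ballx; rewrite divr_gt0.
    by apply: nbhs_right_lt; rewrite divr_gt0.
  move=> [x' e] /= [xx' ed] _; exists b => y Ky x'y; apply: hd => //.
  rewrite (splitr d); apply: ball_triangle xx' _.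
  exact: le_ball (ltW ed) _ x'y.
move=> h; near (0 : R)^'+ => e; exists e => //.
by near: e.
Unshelve. all: by end_near. Qed.

Let sq : set (R * R) := @I01 R `*` @I01 R.

Definition subsquare (H : R * R -> X) (a b : R -> R) : R * R -> X :=
  fun st => H (a st.1, b st.2).

(** The Lebesgue argument as an induction principle: a property of small squares that passes from
    the four quarters to the whole holds for all squares. *)
Lemma dsquare_ind (Q : (R * R -> X) -> Prop) :
  (forall b H, dsquare D (Y b) H -> Q H) ->
  (forall H, dsquare D setT H ->
    Q (subsquare H half0 half0) -> Q (subsquare H half0 half1) ->
    Q (subsquare H half1 half0) -> Q (subsquare H half1 half1) -> Q H) ->
  forall H, dsquare D setT H -> Q H.
Proof.
move=> Qbase Qstep H sH.
pose mesh (e : R) (H : R * R -> X) := forall s t, I01 s -> I01 t ->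
  exists b, forall u v, I01 u -> I01 v -> 
    `|s - u| < e -> `|t - v| < e -> Y b (H (u, v)).
(* Passing to a quarter magnifies distances by two, so the Lebesgue number doubles. *)
have meshS e H' a b : mesh e H' -> (a = half0 \/ a = half1) ->
    (b = half0 \/ b = half1) -> mesh (2 * e) (subsquare H' a b).
  move=> m ha hb s t s01 t01.
  have na (c : R -> R) : c = half0 \/ c = half1 -> ndmap c by case=> ->.
  have dist (c : R -> R) (u v : R) : c = half0 \/ c = half1 ->
      `|u - v| < 2 * e -> `|c u - c v| < e.
    move=> hc uv; have -> : c u - c v = 2^-1 * (u - v).
      by case: hc => ->; rewrite /half0 /half1; lra.
    by rewrite normrM ger0_norm; lra.
  have [k hk] := m _ _ (ndmap_I01 (na _ ha) s01) (ndmap_I01 (na _ hb) t01).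
  exists k => u v u01 v01 su tv; apply: hk; by [exact: ndmap_I01 (na _ ha) u01 |
    exact: ndmap_I01 (na _ hb) v01 | exact: dist].
have Qmesh n : forall e H', 1 <= 2 ^+ n * e ->
    dsquare D setT H' -> mesh e H' -> Q H'.
  elim: n => [|n IH] e H' ne sH' m.
    (* Here $e\ge 1$, and every point of the square is within $1/2$ of the centre in each
       coordinate, so a single piece contains the image. *)
    have h01 : I01 (2^-1 : R) by rewrite /I01 /=; lra.
    have [b hb] := m _ _ h01 h01; apply: (Qbase b); apply: dsquare_in => // s t s01 t01.
    move: s01 t01 ne; rewrite /I01 /= => s01 t01 ne.
    by apply: hb => //; rewrite ltr_norml; lra.
  have ne' : 1 <= 2 ^+ n * (2 * e) by rewrite mulrA -exprSr.
  by apply: Qstep => //; (apply: (IH (2 * e)) => //;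
    [apply: dsquare_comp | apply: meshS; auto]).
have csq : compact sq.
  have cI : compact (@I01 R).
    have -> : @I01 R = `[0, 1]%classic by rewrite set_itvE.
    exact: segment_compact.
  exact: compact_setX.
have [e e0 he] := lebesgue_number csq sH.1.
have [n ne] : exists n, 1 <= 2 ^+ n * e.
  exists (Num.bound e^-1); rewrite -ler_pdivrMr // mul1r.
  have e1 : 0 <= e^-1 by rewrite invr_ge0 ltW.
  apply: (le_trans (ltW (archi_boundP e1))).
  by rewrite -natrX ler_nat ltnW // ltn_expl.
apply: (Qmesh n e) => // s t s01 t01.
have [//|b hb] := he (s, t); exists b => u v u01 v01 su tv.
by apply: hb.
Qed.

(** A path is a square that does not depend on the first coordinate, and the left edges of the two
    left quarters are its halves. *)
Lemma dpath_ind (Q : (R -> X) -> Prop) :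
  (forall b p, dipath_in D (Y b) p -> Q p) ->
  (forall p, dpath D p -> Q (fun t => p (half0 t)) -> Q (fun t => p (half1 t)) -> Q p) ->
  forall p, dpath D p -> Q p.
Proof.
move=> Qbase Qstep p dp.
suff h H : dsquare D setT H -> Q (fun t => H (0, t)) by
  exact: (h _ (dsquare_path (dpathT dp))).
move: H; apply: (@dsquare_ind (fun H => Q (fun t => H (0, t)))).
  by move=> b H [_ dH]; apply: (Qbase b); apply: (dH (fun=> 0) id) => //; exact: ndmap_cst.
move=> H [_ dH]; rewrite /subsquare /= half00 => q00 q01 _ _; apply: Qstep => //.
by case: (dH (fun=> 0) id) => //; exact: ndmap_cst.
Qed.

End Lebesgue.

(** * The van Kampen theorem *)

Section VanKampen.
Context {R : realType} {X : topologicalType} (D : dspace R X) (Y : bool -> set X).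
Hypothesis Ycover : forall x, exists b, interior (Y b) x.
Context (E : cat) (isE : IsCat E).
Context (G : forall b, functor (pi1 D (Y b) (Y b)) E).
Hypothesis isG : forall b, IsFunctor (G b).
Hypothesis Gob : forall x, Y true x -> Y false x -> fob (G true) x = fob (G false) x.
Hypothesis Garr : forall p, dipath_in D (Y true) p -> dipath_in D (Y false) p ->
  aeq E (farr (G true) p) (farr (G false) p).
Implicit Types (p q : R -> X) (H : R * R -> X).

Let homY b p : dipath_in D (Y b) p -> hom (pi1 D (Y b) (Y b)) p.
Proof. by move=> dp; split=> //; split; apply: dp.2. Qed.

Definition glue_ob x : ob E :=
  if `[< Y true x >] then fob (G true) x else fob (G false) x.

Definition glue_arr p : arr E :=
  if `[< dipath_in D (Y true) p >] then farr (G true) p else farr (G false) p.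

Lemma glue_obE b x : Y b x -> glue_ob x = fob (G b) x.
Proof.
rewrite /glue_ob; case: asboolP => Y1; case: b => // Y2; exact: Gob.
Qed.

Lemma glue_ob_obP x : obP E (glue_ob x).
Proof.
have [b /interior_subset Yx] := Ycover x.
by rewrite (glue_obE Yx); apply: (isG b).1.
Qed.

Lemma G_is_arr b p : dipath_in D (Y b) p ->
  is_arr (farr (G b) p) (glue_ob (p 0)) (glue_ob (p 1)).
Proof.
move=> dp; have [h [e1 e2]] := (isG b).2.1 p (homY dp).
rewrite (glue_obE (dp.2 0 I010)) (glue_obE (dp.2 1 I011)); split=> //.
Qed.

Lemma G_dieq b p q : dipath_in D (Y b) p -> dieq D (Y b) p q ->
  heq (farr (G b) p) (farr (G b) q).
Proof.
move=> dp pq; have dq := (dieq_dipath pq).1 dp.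
have [h1 _ _] := G_is_arr dp; have [h2 _ _] := G_is_arr dq.
by split=> //; apply: (isG b).2.2.1 pq; exact: homY.
Qed.

Lemma G_concat b p q : dipath_in D (Y b) p -> dipath_in D (Y b) q -> p 1 = q 0 ->
  heq (farr (G b) (concat p q)) (cmp E (farr (G b) p) (farr (G b) q)).
Proof.
move=> dp dq pq; have [h1 _ _] := G_is_arr (dipath_concat dp dq pq).
have a1 := G_is_arr dp; have a2 := G_is_arr dq; rewrite pq in a1.
have [h2 _ _] := is_arr_cmp isE a1 a2.
by split=> //; apply: (isG b).2.2.2.2 => //; exact: homY.
Qed.

Lemma glue_arrE b p : dipath_in D (Y b) p -> heq (glue_arr p) (farr (G b) p).
Proof.
move=> dp; rewrite /glue_arr; case: asboolP => d1.
  case: b dp => dp; have [h _ _] := G_is_arr dp; first exact: heq_refl.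
  by have [h' _ _] := G_is_arr d1; split=> //; exact: Garr.
by case: b dp => // dp; have [h _ _] := G_is_arr dp; exact: heq_refl.
Qed.

(** All leaves of the subdivision have the same depth [n]. Two subdivisions of a path then have a
    common refinement, obtained by raising both depths to their sum. *)
Fixpoint small n p : Prop :=
  if n is m.+1 then small m (fun t => p (half0 t)) /\ small m (fun t => p (half1 t))
  else exists b, dipath_in D (Y b) p.

Fixpoint dyadic n p : arr E :=
  if n is m.+1 then
    cmp E (dyadic m (fun t => p (half0 t))) (dyadic m (fun t => p (half1 t)))
  else glue_arr p.

Lemma dyadic_is_arr n p : small n p ->
  is_arr (dyadic n p) (glue_ob (p 0)) (glue_ob (p 1)).
Proof.
elim: n p => [|n IH] p /=.
  by move=> [b dp]; refine (heq_is_arr isE (heq_sym isE (glue_arrE dp)) (G_is_arr dp)).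
move=> [/IH + /IH]; rewrite half00 half10 half11; exact: is_arr_cmp.
Qed.

Lemma dyadic_eqI n p q : small n p -> eqI p q ->
  small n q /\ heq (dyadic n p) (dyadic n q).
Proof.
elim: n p q => [|n IH] p q /=.
  move=> [b dp] pq; have dq := dipath_eqI dp pq; split; first by exists b.
  apply: (heq_trans isE (glue_arrE dp) _).
  apply: (heq_trans isE _ (heq_sym isE (glue_arrE dq))).
  by apply: G_dieq => //; exact: dieq_eqI.
move=> [s0 s1] pq.
have [|s0' e0] := IH _ (fun t => q (half0 t)) s0.
  by move=> t t01; apply: pq; exact: ndmap_I01.
have [|s1' e1] := IH _ (fun t => q (half1 t)) s1.
  by move=> t t01; apply: pq; exact: ndmap_I01.
split=> //; apply: heq_cmp => //.
have [_ _ ->] := dyadic_is_arr s0; have [_ -> _] := dyadic_is_arr s1.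
by rewrite half10.
Qed.

(** Only the leaves are split; there the path stays in one piece and functoriality of [G b]
    applies. *)
Lemma dyadicS n p : small n p -> small n.+1 p /\ heq (dyadic n p) (dyadic n.+1 p).
Proof.
elim: n p => [|n IH] p.
  move=> [b dp].
  have d0 : dipath_in D (Y b) (fun t => p (half0 t)) by exact: dipath_comp.
  have d1 : dipath_in D (Y b) (fun t => p (half1 t)) by exact: dipath_comp.
  split; first by split; exists b.
  apply: (heq_trans isE (glue_arrE dp) _); rewrite -{1}(concat_halves p).
  apply: (heq_trans isE (G_concat d0 d1 _) _); first by rewrite half10.
  apply: heq_cmp => //; try exact/(heq_sym isE)/glue_arrE.
  have [_ _ ->] := G_is_arr d0; have [_ -> _] := G_is_arr d1.
  by rewrite half10.
move=> [s0 s1]; have [s0' e0] := IH _ s0; have [s1' e1] := IH _ s1.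
split; first by split.
apply: heq_cmp => //.
have [_ _ ->] := dyadic_is_arr s0; have [_ -> _] := dyadic_is_arr s1.
by rewrite half10.
Qed.

Lemma dyadicD k n p : small n p ->
  small (k + n) p /\ heq (dyadic n p) (dyadic (k + n) p).
Proof.
move=> sn; elim: k => [|k [sk ek]].
  by split=> //; apply: heq_refl => //; case: (dyadic_is_arr sn).
have [s e] := dyadicS sk; split; first exact: s.
exact: (heq_trans isE ek e).
Qed.

Lemma dyadic_indep m n p : small m p -> small n p -> heq (dyadic m p) (dyadic n p).
Proof.
move=> sm sn; have [_ e1] := dyadicD n sm; have [_ e2] := dyadicD m sn.
by apply: (heq_trans isE e1 _); rewrite addnC; exact: heq_sym.
Qed.

Lemma small_exists p : dpath D p -> exists n, small n p.
Proof.
move: p; apply: (dpath_ind Ycover) => [b p dp|p dp [m sm] [n sn]].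
  by exists 0%N; exists b.
exists (m + n).+1; split; last exact: (dyadicD m sn).1.
by rewrite addnC; exact: (dyadicD n sm).1.
Qed.

(** Any admissible depth gives the same arrow by [dyadic_indep]; for a dipath one exists by
    [small_exists], so the default is not reached. *)
Definition vk_arr p : arr E := dyadic (xget 0%N [set n | small n p]) p.

Lemma vk_arrE n p : small n p -> heq (vk_arr p) (dyadic n p).
Proof.
move=> sn; apply: dyadic_indep => //.
by apply: (@xgetPex _ 0%N [set n | small n p]); exists n.
Qed.

Lemma vk_is_arr p : dpath D p -> is_arr (vk_arr p) (glue_ob (p 0)) (glue_ob (p 1)).
Proof.
move=> /small_exists[n sn].
exact: (heq_is_arr isE (heq_sym isE (vk_arrE sn)) (dyadic_is_arr sn)).
Qed.

Lemma vk_hom p : dpath D p -> hom E (vk_arr p). Proof. by case/vk_is_arr. Qed.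

Lemma vk_eqI p q : dpath D p -> eqI p q -> heq (vk_arr p) (vk_arr q).
Proof.
move=> /small_exists[n sn] pq; have [sn' e] := dyadic_eqI sn pq.
apply: (heq_trans isE (vk_arrE sn) (heq_trans isE e (heq_sym isE (vk_arrE sn')))).
Qed.

Lemma vk_halves p : dpath D p ->
  heq (vk_arr p) (cmp E (vk_arr (fun t => p (half0 t))) (vk_arr (fun t => p (half1 t)))).
Proof.
move=> /small_exists[n /dyadicS[sn _]].
apply: (heq_trans isE (vk_arrE sn) _); case: sn => /= s0 s1.
apply: (heq_cmp isE (heq_sym isE (vk_arrE s0)) (heq_sym isE (vk_arrE s1)) _).
have [_ _ ->] := dyadic_is_arr s0; have [_ -> _] := dyadic_is_arr s1.
by rewrite half10.
Qed.

Lemma vk_concat p q : dpath D p -> dpath D q -> p 1 = q 0 ->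
  heq (vk_arr (concat p q)) (cmp E (vk_arr p) (vk_arr q)).
Proof.
move=> dp dq pq; have dc := dpath_concat dp dq pq.
apply: (heq_trans isE (vk_halves dc) _).
apply: heq_cmp => //.
- apply: vk_eqI; first exact: (dpath_reparam dc ndmap_half0).
  exact: concat_half0.
- apply: vk_eqI; first exact: (dpath_reparam dc ndmap_half1).
  exact: concat_half1.
have [_ _ ->] := vk_is_arr (dpath_reparam dc ndmap_half0).
have [_ -> _] := vk_is_arr (dpath_reparam dc ndmap_half1).
by rewrite /= half10.
Qed.

Lemma vk_arr_in b p : dipath_in D (Y b) p -> heq (vk_arr p) (farr (G b) p).
Proof.
move=> dp; apply: (heq_trans isE (@vk_arrE 0 p _) (glue_arrE dp)).
by exists b.
Qed.

Lemma vk_cst x : heq (vk_arr (fun=> x)) (idn E (glue_ob x)).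
Proof.
have [b /interior_subset Yx] := Ycover x.
apply: (heq_trans isE (vk_arr_in (dipath_cst D Yx)) _); split.
- by case: (G_is_arr (dipath_cst D Yx)).
- by case: (is_arr_idn isE (glue_ob_obP x)).
- by rewrite (glue_obE Yx); apply: (isG b).2.2.2.1.
Qed.

Lemma vk_square H : dsquare D setT H ->
  heq (cmp E (vk_arr (fun t => H (0, t))) (vk_arr (fun s => H (s, 1))))
      (cmp E (vk_arr (fun s => H (s, 0))) (vk_arr (fun t => H (1, t)))).
Proof.
have edge (H' : R * R -> X) (a b : R -> R) : dsquare D setT H' ->
    ndmap a -> ndmap b -> dpath D (fun t => H' (a t, b t)).
  by move=> [_ dH] na nb; case: (dH a b na nb).
have nc0 : ndmap (fun _ : R => 0 : R) by exact: ndmap_cst.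
have nc1 : ndmap (fun _ : R => 1 : R) by exact: ndmap_cst.
move: H; apply: (dsquare_ind Ycover) => [b H sH|H sH].
  have sH' : dsquare D setT H by exact: dsquare_sub sH.
  have d1 := edge _ _ _ sH' nc0 ndmap_id; have d2 := edge _ _ _ sH' ndmap_id nc1.
  have d3 := edge _ _ _ sH' ndmap_id nc0; have d4 := edge _ _ _ sH' nc1 ndmap_id.
  apply: (heq_trans isE (heq_sym isE (vk_concat d1 d2 erefl)) _).
  apply: (heq_trans isE _ (vk_concat d3 d4 erefl)).
  (* Both boundary paths are [H] along monotone paths of the square with common ends, hence they are
     dihomotopic inside the piece. *)
  have n1 : ndmap (concat (fun=> 0) (fun t => t) : R -> R) by exact: ndmap_concat.
  have n2 : ndmap (concat (fun t => t) (fun=> 1) : R -> R) by exact: ndmap_concat.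
  have cc (f g h k : R -> R) :
      concat (fun t => H (f t, g t)) (fun t => H (h t, k t)) =
      (fun t => H (concat f h t, concat g k t)).
    by apply/funext => t; rewrite /concat; case: ifP.
  rewrite [concat _ _](cc (fun=> 0) (fun t => t) (fun t => t) (fun=> 1)).
  rewrite [concat (fun t => H (t, 0)) _](cc (fun t => t) (fun=> 0) (fun=> 1) (fun t => t)).
  have h : dieq D (Y b)
      (fun t => H (concat (fun=> 0) (fun t => t) t, concat (fun t => t) (fun=> 1) t))
      (fun t => H (concat (fun t => t) (fun=> 1) t, concat (fun=> 0) (fun t => t) t)).
    by apply: (dsquare_dieq sH n1 n2 n2 n1); rewrite ?concat0 ?concat1.
  have hd := sH.2 _ _ n1 n2; have hd' := (dieq_dipath h).1 hd.
  apply: (heq_trans isE (vk_arr_in hd) _).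
  by apply: (heq_trans isE (G_dieq hd h) (heq_sym isE (vk_arr_in hd'))).
rewrite /subsquare /= half00 half11 half10.
(* The twelve half-edges of the four quarters: [p] and [q] are the sides $s=0$ and $s=1$, [l] and
   [r] the sides $t=0$ and $t=1$, [m] and [n] the middle lines $t=1/2$ and $s=1/2$. *)
set p0 := fun t => H (0, half0 t); set p1 := fun t => H (0, half1 t).
set q0 := fun t => H (1, half0 t); set q1 := fun t => H (1, half1 t).
set l0 := fun s => H (half0 s, 0); set l1 := fun s => H (half1 s, 0).
set r0 := fun s => H (half0 s, 1); set r1 := fun s => H (half1 s, 1).
set m0 := fun s => H (half0 s, half0 1); set m1 := fun s => H (half1 s, half0 1).
set n0 := fun t => H (half0 1, half0 t); set n1 := fun t => H (half0 1, half1 t).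
move=> s00 s01 s10 s11.
have nch : ndmap (fun _ : R => half0 1 : R) by apply/ndmap_cst/ndmap_I01.
have A f u v : dpath D f -> f 0 = u -> f 1 = v ->
    is_arr (vk_arr f) (glue_ob u) (glue_ob v).
  by move=> df <- <-; exact: vk_is_arr.
have ap0 := A p0 _ _ (edge _ _ _ sH nc0 ndmap_half0) erefl erefl.
have ap1 := A p1 _ _ (edge _ _ _ sH nc0 ndmap_half1) erefl erefl.
have aq0 := A q0 _ _ (edge _ _ _ sH nc1 ndmap_half0) erefl erefl.
have aq1 := A q1 _ _ (edge _ _ _ sH nc1 ndmap_half1) erefl erefl.
have al0 := A l0 _ _ (edge _ _ _ sH ndmap_half0 nc0) erefl erefl.
have al1 := A l1 _ _ (edge _ _ _ sH ndmap_half1 nc0) erefl erefl.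
have ar0 := A r0 _ _ (edge _ _ _ sH ndmap_half0 nc1) erefl erefl.
have ar1 := A r1 _ _ (edge _ _ _ sH ndmap_half1 nc1) erefl erefl.
have am0 := A m0 _ _ (edge _ _ _ sH ndmap_half0 nch) erefl erefl.
have am1 := A m1 _ _ (edge _ _ _ sH ndmap_half1 nch) erefl erefl.
have an0 := A n0 _ _ (edge _ _ _ sH nch ndmap_half0) erefl erefl.
have an1 := A n1 _ _ (edge _ _ _ sH nch ndmap_half1) erefl erefl.
move: ap0 ap1 aq0 aq1 al0 al1 ar0 ar1 am0 am1 an0 an1.
rewrite /p0 /p1 /q0 /q1 /l0 /l1 /r0 /r1 /m0 /m1 /n0 /n1 !half00 !half11 !half10.
rewrite -/p0 -/p1 -/q0 -/q1 -/l0 -/l1 -/r0 -/r1 -/m0 -/m1 -/n0 -/n1.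
move=> ap0 ap1 aq0 aq1 al0 al1 ar0 ar1 am0 am1 an0 an1.
(* Pasting in the $t$ direction gives the halves $s\le 1/2$ and $s\ge 1/2$. Pasting these in the $s$
   direction exchanges the roles of the edges, so both equalities are reversed. *)
have row0 := paste_squares isE ap0 ap1 am0 ar0 al0 an0 an1 s00 s01.
have row1 := paste_squares isE an0 an1 am1 ar1 al1 aq0 aq1 s10 s11.
have full := paste_squares isE al0 al1 (is_arr_cmp isE an0 an1)
  (is_arr_cmp isE aq0 aq1) (is_arr_cmp isE ap0 ap1) ar0 ar1
  (heq_sym isE row0) (heq_sym isE row1).
have hp := vk_halves (edge _ _ _ sH nc0 ndmap_id).
have hq := vk_halves (edge _ _ _ sH nc1 ndmap_id).
have hl := vk_halves (edge _ _ _ sH ndmap_id nc0).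
have hr := vk_halves (edge _ _ _ sH ndmap_id nc1).
have [_ _ ep] := vk_is_arr (edge _ _ _ sH nc0 ndmap_id).
have [_ er _] := vk_is_arr (edge _ _ _ sH ndmap_id nc1).
have [_ _ el] := vk_is_arr (edge _ _ _ sH ndmap_id nc0).
have [_ eq _] := vk_is_arr (edge _ _ _ sH nc1 ndmap_id).
apply: (heq_trans isE (heq_cmp isE hp hr _) _); first by rewrite ep er.
apply: (heq_trans isE (heq_sym isE full) (heq_sym isE _)).
by apply: (heq_cmp isE hl hq _); rewrite el eq.
Qed.

Lemma vk_dihom p q : dihom D setT p q -> heq (vk_arr p) (vk_arr q).
Proof.
move=> pq; have [[dp _] [dq _] e0 e1] := dihom_ends pq.
have [H [cH [dH [f g]]]] := pq.
have sq := @vk_square H (conj cH dH).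
have nc0 : ndmap (fun _ : R => 0 : R) by exact: ndmap_cst.
have nc1 : ndmap (fun _ : R => 1 : R) by exact: ndmap_cst.
have h0 : heq (vk_arr (fun t => H (0, t))) (vk_arr p).
  apply: vk_eqI; first exact: (dH _ _ nc0 ndmap_id).1.
  by move=> t t01; case: (g t t01).
have h1 : heq (vk_arr (fun t => H (1, t))) (vk_arr q).
  apply: vk_eqI; first exact: (dH _ _ nc1 ndmap_id).1.
  by move=> t t01; case: (g t t01).
have hl : heq (vk_arr (fun s => H (s, 0))) (idn E (glue_ob (q 0))).
  apply: (heq_trans isE _ (vk_cst _)).
  apply: vk_eqI; first exact: (dH _ _ ndmap_id nc0).1.
  by move=> t t01; rewrite (f t t01).1.
have hr : heq (vk_arr (fun s => H (s, 1))) (idn E (glue_ob (p 1))).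
  apply: (heq_trans isE _ (vk_cst _)).
  apply: vk_eqI; first exact: (dH _ _ ndmap_id nc1).1.
  by move=> t t01; rewrite (f t t01).2.
have [hp _ tp] := vk_is_arr dp; have [hq sq' _] := vk_is_arr dq.
have ip : heq (cmp E (vk_arr p) (idn E (glue_ob (p 1)))) (vk_arr p).
  by rewrite -tp; exact: heq_idr.
have iq : heq (cmp E (idn E (glue_ob (q 0))) (vk_arr q)) (vk_arr q).
  by rewrite -sq'; exact: heq_idl.
have [_ ip0 _] := is_arr_idn isE (glue_ob_obP (p 1)).
have [_ _ iq1] := is_arr_idn isE (glue_ob_obP (q 0)).
apply: (heq_trans isE (heq_sym isE ip) _).
apply: (heq_trans isE (heq_cmp isE (heq_sym isE h0) (heq_sym isE hr) _) _).
  by rewrite tp ip0.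
apply: (heq_trans isE sq _).
apply: (heq_trans isE (heq_sym isE (heq_cmp isE (heq_sym isE hl) (heq_sym isE h1) _)) iq).
by rewrite sq' iq1.
Qed.

Lemma vk_dieq p q : dpath D p -> dieq D setT p q -> heq (vk_arr p) (vk_arr q).
Proof.
move=> dp pq; elim: pq dp => [x y xy _|x dx|x y xy IH dy|x y z xy IH1 yz IH2 dx].
- exact: vk_dihom.
- exact/heq_refl/vk_hom.
- by apply/(heq_sym isE)/IH; case: ((dieq_dipath xy).2 (dpathT dy)).
- apply: (heq_trans isE (IH1 dx) (IH2 _)).
  by case: ((dieq_dipath xy).1 (dpathT dx)).
Qed.

(** The object set is a set [A] containing every point, because it is later a union of the two
    pieces. Uniqueness is again by induction on subdivisions. *)
Lemma van_kampen_functor (A : set X) : (forall x, A x) ->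
  exists F : functor (pi1 D setT A) E,
    [/\ IsFunctor F, forall b, feq (fcomp (pincl D (Y b) (Y b) setT A) F) (G b) &
     forall F' : functor (pi1 D setT A) E, IsFunctor F' ->
       (forall b, feq (fcomp (pincl D (Y b) (Y b) setT A) F') (G b)) -> feq F' F].
Proof.
move=> AT; exists (@Functor (pi1 D setT A) E glue_ob vk_arr); split.
- split=> [a _|]; first exact: glue_ob_obP.
  split=> [p [[dp _] _]|]; first by case: (vk_is_arr dp).
  split=> [p q [[dp _] _] _ pq|]; first by case: (vk_dieq dp pq).
  split=> [a _|p q [[dp _] _] [[dq _] _] pq]; first by case: (vk_cst a).
  by case: (vk_concat dp dq pq).
- move=> b; split=> [x Yx|p [dp _]]; first exact: glue_obE.
  by case: (vk_arr_in dp).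
move=> F' isF' FG.
have Fob b x : Y b x -> fob F' x = fob (G b) x by exact: (FG b).1.
have Farr b p : dipath_in D (Y b) p -> aeq E (farr F' p) (farr (G b) p).
  by move=> dp; apply: (FG b).2; exact: homY.
have eob x : fob F' x = glue_ob x.
  by have [b /interior_subset Yx] := Ycover x; rewrite (Fob b) // (glue_obE Yx).
split=> [x _|p [[dp _] _]]; first exact: eob.
suff [] : heq (farr F' p) (vk_arr p) by [].
have F'hom q : dpath D q -> hom (pi1 D setT A) q.
  by move=> dq; split=> //; split; exact: AT.
have F'arr q : dpath D q -> is_arr (farr F' q) (glue_ob (q 0)) (glue_ob (q 1)).
  move=> /F'hom hq; have [h [e1 e2]] := isF'.2.1 q hq.
  by split; [exact: h | rewrite e1 eob | rewrite e2 eob].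
move: p dp; apply: (dpath_ind Ycover) => [b p dp|p dp IH0 IH1].
  apply: (heq_trans isE _ (heq_sym isE (vk_arr_in dp))).
  split; [by case: (F'arr p dp.1) | by case: (G_is_arr dp) | exact: Farr].
have d0 := dpath_reparam dp ndmap_half0; have d1 := dpath_reparam dp ndmap_half1.
have [_ _ t0] := F'arr _ d0; have [_ s1 _] := F'arr _ d1.
have et : tgt E (farr F' (fun t => p (half0 t))) =
    src E (farr F' (fun t => p (half1 t))).
  by rewrite t0 s1 /= half10.
apply: (heq_trans isE _ (heq_sym isE (vk_halves dp))).
apply: (heq_trans isE _ (heq_cmp isE IH0 IH1 et)).
rewrite -{1}(concat_halves p); split.
- by rewrite concat_halves; case: (F'arr _ dp).
- by case: (heq_cmp isE IH0 IH1 et).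
- apply: isF'.2.2.2.2 => /=; last by rewrite half10.
    exact: F'hom.
  exact: F'hom.
Qed.

End VanKampen.

(** * Future and past retracts *)

Section Retracts.
Context {R : realType} {X : topologicalType} (D : dspace R X).
Implicit Types (Y A B : set X) (p q : R -> X).

(* The unit of a future retract goes from [lower_fun true P] (the identity) to
   [lower_fun false P] (the retraction); the counit of a past retract goes the
   other way, so both cases are treated at once. *)
Definition lower_fun (fut : bool) Y B A (P : functor (pi1 D Y B) (pi1 D Y A)) :
    functor (pi1 D Y B) (pi1 D Y B) :=
  if fut then fid (pi1 D Y B) else fcomp P (pincl D Y A Y B).

(** Only the unit of a future retract, or the counit of a past one, is recorded. The other
    transformation is an identity, so the remaining content of the triangle laws is that [eta] is
    trivial on [A] and that [P] sends it to identities. *)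
Definition is_retract (fut : bool) Y B A (P : functor (pi1 D Y B) (pi1 D Y A))
    (eta : X -> R -> X) : Prop :=
  [/\ IsFunctor P,
      IsNat (lower_fun fut P) (lower_fun (~~ fut) P) eta,
      forall a, A a -> dieq D Y (eta a) (fun=> a) &
      forall x, B x -> dieq D Y (farr P (eta x)) (fun=> fob P x)].

Lemma fid_IsFunctor (C : cat) : IsCat C -> IsFunctor (fid C).
Proof.
move=> isC; split=> //; split=> //; split=> //; split=> [a oa|f g hf hg fg].
  by have [h _ _] := is_arr_idn isC oa; case: (heq_refl isC h).
have [] := @is_arr_cmp C isC f g (src C f) (tgt C f) (tgt C g) => // h _ _.
by case: (heq_refl isC h).
Qed.

Lemma fcomp_IsFunctor (C1 C2 C3 : cat) (F : functor C1 C2) (G : functor C2 C3) :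
  IsCat C1 -> IsCat C2 -> IsCat C3 -> IsFunctor F -> IsFunctor G -> IsFunctor (fcomp F G).
Proof.
move=> isC1 isC2 isC3 iF iG.
have [Fo [Fa [Fe [Fi Fc]]]] := iF; have [Go [Ga [Ge [Gi Gc]]]] := iG.
split=> [a /Fo/Go //|]; split=> [f hf|].
  have [h [e1 e2]] := Fa f hf; have [h' [e1' e2']] := Ga _ h.
  by rewrite /= -e1 -e2.
split=> [f g hf hg fg|].
  by apply: Ge (Fe _ _ hf hg fg); [case: (Fa f hf) | case: (Fa g hg)].
split=> [a oa|f g hf hg fg] /=.
  have hh : heq (farr F (idn C1 a)) (idn C2 (fob F a)).
    split; last exact: Fi.
      by have [h _ _] := is_arr_idn isC1 oa; case: (Fa _ h).
    by case: (is_arr_idn isC2 (Fo a oa)).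
  have hg : heq (farr G (farr F (idn C1 a))) (farr G (idn C2 (fob F a))).
    by case: hh => h1 h2 h3; split; [case: (Ga _ h1)|case: (Ga _ h2)|exact: Ge].
  suff [] : heq (farr G (farr F (idn C1 a))) (idn C3 (fob G (fob F a))) by [].
  apply: (heq_trans isC3 hg); case: hg => _ h _; split=> //.
    by case: (is_arr_idn isC3 (Go _ (Fo a oa))).
  exact/Gi/Fo.
have [h1 [s1 t1]] := Fa f hf; have [h2 [s2 t2]] := Fa g hg.
have e : tgt C2 (farr F f) = src C2 (farr F g) by rewrite t1 s2 fg.
have hh : heq (farr F (cmp C1 f g)) (cmp C2 (farr F f) (farr F g)).
  split; last exact: Fc.
    have [] := @is_arr_cmp C1 isC1 f g (src C1 f) (tgt C1 f) (tgt C1 g) => // h _ _.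
    by case: (Fa _ h).
  by have [] := @is_arr_cmp C2 isC2 (farr F f) (farr F g) _ _ _ (And3 h1 erefl e)
    (And3 h2 erefl erefl).
have hg' : heq (farr G (farr F (cmp C1 f g))) (farr G (cmp C2 (farr F f) (farr F g))).
  by case: hh => h3 h4 h5; split; [case: (Ga _ h3)|case: (Ga _ h4)|exact: Ge].
suff [] : heq (farr G (farr F (cmp C1 f g)))
  (cmp C3 (farr G (farr F f)) (farr G (farr F g))) by [].
apply: (heq_trans isC3 hg'); case: hg' => _ h _; split=> //; last exact: Gc.
have [h1' [s1' t1']] := Ga _ h1; have [h2' [s2' t2']] := Ga _ h2.
by have [] := @is_arr_cmp C3 isC3 (farr G (farr F f)) (farr G (farr F g)) _ _ _
  (And3 h1' erefl erefl) (And3 h2' _ erefl); rewrite ?s2' ?t1' ?e.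
Qed.

Lemma lower_fun_IsFunctor fut Y B A (P : functor (pi1 D Y B) (pi1 D Y A)) :
  A `<=` B -> B `<=` Y -> IsFunctor P -> IsFunctor (lower_fun fut P).
Proof.
move=> AB BY iP; have AY : A `<=` Y by move=> x /AB /BY.
case: fut; first exact/fid_IsFunctor/pi1_IsCat.
by apply: fcomp_IsFunctor => //; try exact: pi1_IsCat; exact: pincl_IsFunctor.
Qed.

Section OneRetract.
Context (fut : bool) (Y B A : set X) (P : functor (pi1 D Y B) (pi1 D Y A)).
Context (eta : X -> R -> X).
Hypotheses (AB : A `<=` B) (BY : B `<=` Y).
Hypothesis isP : is_retract fut P eta.

Lemma retract_ob a : A a -> fob P a = a.
Proof.
case: isP => _ [hn _] he _ Aa; have [h0 h1] := dieq_ends (he _ Aa).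
have [_ [s t]] := hn a (AB Aa); move: s t h0 h1; rewrite /lower_fun /=.
by case: (fut) => /= s t h0 h1; [rewrite -t | rewrite -s].
Qed.

(** This is the naturality square of [eta] at [p], whose components at the ends of [p] are trivial;
    [key] cancels them. *)
Lemma retract_arr p : hom (pi1 D Y A) p -> dieq D Y (farr P p) p.
Proof.
move=> hp; have [dp [p0 p1]] := hp.
have hpB : hom (pi1 D Y B) p by split=> //; split; exact: AB.
case: isP => [[_ [Pa _]] [hn nat] he _].
have [hPp [Ps Pt]] := Pa p hpB; have dPp := hPp.1.
rewrite /= retract_ob // in Ps; rewrite /= retract_ob // in Pt.
have Yp0 := BY (AB p0); have Yp1 := BY (AB p1).
have [e00 e01] := dieq_ends (he _ p0); have [e10 e11] := dieq_ends (he _ p1).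
have d0 : dipath_in D Y (eta (p 0)) by apply/(dieq_dipath (he _ p0)).2/dipath_cst.
have key f g : dipath_in D Y f -> dipath_in D Y g -> f 0 = p 0 -> f 1 = p 1 ->
    g 0 = p 0 -> g 1 = p 1 ->
    dieq D Y (concat f (eta (p 1))) (concat (eta (p 0)) g) -> dieq D Y f g.
  move=> df dg f0 f1 g0 g1 fg.
  apply: dieq_trans (dieq_sym (concat_cst_r df)) _.
  apply: (dieq_trans (q := concat f (eta (p 1)))).
    apply: dieq_concat => //; first by rewrite f1; exact: dipath_cst.
      exact: dieq_refl.
    by rewrite f1; exact: dieq_sym (he _ p1).
  apply: dieq_trans fg _; apply: (dieq_trans (q := concat (fun=> p 0) g)).
    apply: dieq_concat => //; first exact: dipath_cst.
    - exact: he.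
    - exact: dieq_refl.
    - by rewrite e01 g0.
  by rewrite -g0; exact: concat_cst_l.
have := nat p hpB; rewrite /lower_fun; case: (fut) => /= h.
  by apply/dieq_sym/key.
exact: key.
Qed.

End OneRetract.

(** The triangle law at [a] in [A], where the unit is trivial, makes the counit trivial as well. The
    other triangle law then loses its counit and says that [P] trivialises the unit. *)
Lemma future_retract_is_retract Y B A (P : functor (pi1 D Y B) (pi1 D Y A)) eta eps :
  A `<=` B -> B `<=` Y -> future_retract P eta eps -> is_retract true P eta.
Proof.
move=> AB BY [[iP [_ [nat [[hn _] [tr1 tr2]]]]] he].
have hA a : A a -> dipath_in D Y (eta a).
  by move=> /[dup] /he/dieq_dipath h Aa; apply/h/dipath_cst/BY/AB.
have Pa a : A a -> fob P a = a.
  move=> Aa; have [_ h1] := dieq_ends (he _ Aa).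
  by have [_ [_ t]] := nat.1 a (AB _ Aa); rewrite /= in t; rewrite -t.
have eps1 a : A a -> dieq D Y (eps a) (fun=> a).
  move=> Aa; have [[de _] [s t]] := hn a Aa; rewrite /= Pa // in s.
  apply: dieq_trans (dieq_sym (concat_cst_l de)) _; rewrite s.
  apply: dieq_trans _ (tr2 a Aa).
  apply: (dieq_concat (hA a Aa) de (dieq_sym (he _ Aa)) (dieq_refl D Y _)).
  by rewrite s.
split=> // x Bx; have [_ [Ph _]] := iP.
have [he1 [s t]] := nat.1 x Bx; have [hP [Ps Pt]] := Ph _ he1.
have APx : A (fob P x) by apply: iP.1.
have [[de _] [s' t']] := hn _ APx.
have Pt' : farr P (eta x) 1 = fob P x.
  by rewrite /= in Pt t; rewrite Pt t Pa.
apply: dieq_trans (dieq_sym (concat_cst_r hP.1)) _; rewrite Pt'.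
apply: dieq_trans _ (tr1 x Bx).
apply: (dieq_concat hP.1 _ (dieq_refl D Y _) (dieq_sym (eps1 _ APx))) => //.
exact/dipath_cst/BY/AB.
Qed.

Lemma past_retract_is_retract Y B A (P : functor (pi1 D Y B) (pi1 D Y A)) eta eps :
  A `<=` B -> B `<=` Y -> past_retract P eta eps -> is_retract false P eps.
Proof.
move=> AB BY [[_ [iP [[hn _] [nat [tr1 tr2]]]]] he].
have hA a : A a -> dipath_in D Y (eps a).
  by move=> /[dup] /he/dieq_dipath h Aa; apply/h/dipath_cst/BY/AB.
have Pa a : A a -> fob P a = a.
  move=> Aa; have [h0 _] := dieq_ends (he _ Aa).
  by have [_ [s _]] := nat.1 a (AB _ Aa); rewrite /= in s; rewrite -s.
have eta1 a : A a -> dieq D Y (eta a) (fun=> a).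
  move=> Aa; have [[de _] [s t]] := hn a Aa; rewrite /= Pa // in t.
  apply: dieq_trans (dieq_sym (concat_cst_r de)) _; rewrite t.
  apply: dieq_trans _ (tr1 a Aa).
  apply: (dieq_concat de _ (dieq_refl D Y _) (dieq_sym (he _ Aa))); last by [].
  exact/dipath_cst/BY/AB.
split=> // x Bx; have [_ [Ph _]] := iP.
have [he1 [s t]] := nat.1 x Bx; have [hP [Ps Pt]] := Ph _ he1.
have APx : A (fob P x) by apply: iP.1.
have [[de _] [s' t']] := hn _ APx.
have Ps' : farr P (eps x) 0 = fob P x.
  by rewrite /= in Ps s; rewrite Ps s Pa.
apply: dieq_trans (dieq_sym (concat_cst_l hP.1)) _; rewrite Ps'.
apply: dieq_trans _ (tr2 x Bx).
by apply: (dieq_concat de hP.1 (dieq_sym (eta1 _ APx)) (dieq_refl D Y _)).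
Qed.

(** The missing transformation is taken to be constant paths; its naturality is the fact that [P]
    fixes the arrows of [A]. *)
Lemma is_retract_adjunction fut Y B A (P : functor (pi1 D Y B) (pi1 D Y A)) eta :
  A `<=` B -> B `<=` Y -> is_retract fut P eta ->
  exists eta' eps', if fut then future_retract P eta' eps' else past_retract P eta' eps'.
Proof.
move=> AB BY isP; have [iP nat he hPe] := isP.
have AY : A `<=` Y by move=> x /AB/BY.
have Pa := retract_ob AB isP; have Pp := retract_arr AB BY isP.
have iI : IsFunctor (pincl D Y A Y B) by exact: pincl_IsFunctor.
have unit1 p : hom (pi1 D Y A) p -> dieq D Y (concat (farr P p) (fun=> p 1)) p.
  move=> hp; have dP : dipath_in D Y (farr P p).
    by apply/(dieq_dipath (Pp p hp)).2; case: hp.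
  by have [e0 e1] := dieq_ends (Pp p hp);
    apply: dieq_trans (Pp p hp); rewrite -e1; exact: concat_cst_r.
have unit2 p : hom (pi1 D Y A) p -> dieq D Y (concat (fun=> p 0) (farr P p)) p.
  move=> hp; have dP : dipath_in D Y (farr P p).
    by apply/(dieq_dipath (Pp p hp)).2; case: hp.
  by have [e0 e1] := dieq_ends (Pp p hp);
    apply: dieq_trans (Pp p hp); rewrite -e0; exact: concat_cst_l.
have cstA a : A a -> dipath_in D Y (fun=> a) by move=> /AY; exact: dipath_cst.
have cc a : A a -> dieq D Y (concat (fun=> a) (fun=> a)) (fun=> a).
  by move=> Aa; exact: (concat_cst_l (cstA a Aa)).
have PhomE x : B x -> hom (pi1 D Y A) (farr P (eta x)).
  by move=> Bx; have [h _] := nat.1 x Bx; case: (iP.2.1 _ h).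
have PA x : B x -> A (fob P x) by apply: iP.1.
case: fut isP nat => isP nat.
  exists eta, (fun a => fun=> a); split; last exact: he.
  split=> //; split=> //; split=> //; split; last split.
  - split=> [a Aa|p hp] /=.
      by rewrite Pa //; split=> //; split=> //; exact: cstA.
    have [dp [p0 p1]] := hp.
    by apply: dieq_trans (unit1 p hp) _; apply/dieq_sym; exact: concat_cst_l.
  - move=> x Bx /=; have [e0 e1] := dieq_ends (hPe x Bx).
    apply: dieq_trans (hPe x Bx); rewrite -e1.
    by apply: concat_cst_r; case: (PhomE x Bx).
  - move=> a Aa /=; apply: dieq_trans (cc a Aa).
    apply: dieq_concat (cstA a Aa) (cstA a Aa) (he a Aa) (dieq_refl D Y _) _.
    by case: (dieq_ends (he a Aa)).
exists (fun a => fun=> a), eta; split; last exact: he.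
split=> //; split=> //; split; last (split; first exact: nat); last split.
- split=> [a Aa|p hp] /=.
    by rewrite Pa //; split=> //; split=> //; exact: cstA.
  have [dp [p0 p1]] := hp.
  by apply: dieq_trans (concat_cst_r dp) _; apply/dieq_sym; exact: unit2.
- move=> a Aa /=; apply: dieq_trans (cc a Aa).
  apply: dieq_concat (cstA a Aa) _ (dieq_refl D Y _) (he a Aa) _.
    by apply/(dieq_dipath (he a Aa)).2; exact: cstA.
  by case: (dieq_ends (he a Aa)).
- move=> x Bx /=; have [e0 e1] := dieq_ends (hPe x Bx).
  apply: dieq_trans (hPe x Bx); rewrite -e0.
  by apply: concat_cst_l; case: (PhomE x Bx).
Qed.

End Retracts.

(** * Pushouts along retracts *)

Section Pushouts.
Context {R : realType} {X : topologicalType} (D : dspace R X).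
Context (Y0 : set X) (Y : bool -> set X).
Hypothesis Y0E : Y0 = Y true `&` Y false.
Implicit Types (p q : R -> X).

Definition setU2 (B : bool -> set X) : set X := B true `|` B false.

Definition jincl (B : bool -> set X) b :
    functor (pi1 D (Y b) (B b)) (pi1 D setT (setU2 B)) :=
  pincl D (Y b) (B b) setT (setU2 B).

(** The universal property for a family indexed by [bool], so that both pieces are handled by one
    argument. *)
Definition pushout_at (B0 : set X) (B : bool -> set X) : Prop :=
  forall (E : cat) (G : forall b, functor (pi1 D (Y b) (B b)) E),
    IsCat E -> (forall b, IsFunctor (G b)) ->
    (forall x, B0 x -> fob (G true) x = fob (G false) x) ->
    (forall p, hom (pi1 D Y0 B0) p -> aeq E (farr (G true) p) (farr (G false) p)) ->
    exists H : functor (pi1 D setT (setU2 B)) E,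
      [/\ IsFunctor H, forall b, feq (fcomp (jincl B b) H) (G b) &
       forall H' : functor (pi1 D setT (setU2 B)) E, IsFunctor H' ->
         (forall b, feq (fcomp (jincl B b) H') (G b)) -> feq H' H].

(** Closure under [dieq] is included because arrows are compared only up to dihomotopy in $X$. *)
Inductive generated (B : bool -> set X) : (R -> X) -> Prop :=
| generated_in b p : hom (pi1 D (Y b) (B b)) p -> generated B p
| generated_concat p q : generated B p -> generated B q -> p 1 = q 0 ->
    generated B (concat p q)
| generated_dieq p q : generated B p -> dieq D setT p q -> generated B q.

Definition generating (B : bool -> set X) : Prop :=
  forall p, hom (pi1 D setT (setU2 B)) p -> generated B p.

Lemma setU2_in (B : bool -> set X) b : B b `<=` setU2 B.
Proof. by case: b => x ?; [left | right]. Qed.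

Lemma hom_setU2 (B : bool -> set X) b p :
  hom (pi1 D (Y b) (B b)) p -> hom (pi1 D setT (setU2 B)) p.
Proof.
move=> [dp [p0 p1]]; split; first exact: dipath_sub dp.
by split; apply: (@setU2_in B b).
Qed.

Lemma hom_dieq Z (A : set X) p q :
  dieq D Z p q -> hom (pi1 D Z A) p -> hom (pi1 D Z A) q.
Proof.
move=> pq [dp [p0 p1]]; have [e0 e1] := dieq_ends pq.
by split; [exact/(dieq_dipath pq).1 | rewrite -e0 -e1].
Qed.

Lemma generated_hom B p : generated B p -> hom (pi1 D setT (setU2 B)) p.
Proof.
elim=> {p} [b p|p q _ [dp [p0 p1]] _ [dq [q0 q1]] pq|p q _ hp pq].
- exact: hom_setU2.
- by split; [exact: dipath_concat | rewrite concat0 concat1].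
- exact: hom_dieq hp.
Qed.

(** Commuting naturality squares can be pasted along composites and are invariant under equality of
    arrows, so it suffices to have them on generators. *)
Lemma IsNat_generated (B : bool -> set X)
    (F G : functor (pi1 D setT (setU2 B)) (pi1 D setT (setU2 B))) eta :
  generating B -> IsFunctor F -> IsFunctor G ->
  (forall x, setU2 B x -> hom (pi1 D setT (setU2 B)) (eta x) /\
     eta x 0 = fob F x /\ eta x 1 = fob G x) ->
  (forall b p, hom (pi1 D (Y b) (B b)) p ->
     dieq D setT (concat (farr F p) (eta (p 1))) (concat (eta (p 0)) (farr G p))) ->
  IsNat F G eta.
Proof.
set C := pi1 D setT (setU2 B) => genB iF iG heta nat; split=> // f /genB gf.
have isC : IsCat C by exact: pi1_IsCat.
have aF p : generated B p -> is_arr (farr F p) (fob F (p 0)) (fob F (p 1)).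
  by move=> /generated_hom hp; case: (iF.2.1 p hp) => ? [].
have aG p : generated B p -> is_arr (farr G p) (fob G (p 0)) (fob G (p 1)).
  by move=> /generated_hom hp; case: (iG.2.1 p hp) => ? [].
have ae x : setU2 B x -> is_arr (C := C) (eta x) (fob F x) (fob G x).
  by move=> /heta [? []].
have Bs p : generated B p -> setU2 B (p 0) /\ setU2 B (p 1).
  by move=> /generated_hom [].
have hl p : generated B p -> hom C (cmp C (farr F p) (eta (p 1))).
  by move=> gp; have [_ b1] := Bs p gp; case: (is_arr_cmp isC (aF p gp) (ae _ b1)).
have hr p : generated B p -> hom C (cmp C (eta (p 0)) (farr G p)).
  by move=> gp; have [b0 _] := Bs p gp; case: (is_arr_cmp isC (ae _ b0) (aG p gp)).
suff [] : heq (C := C) (cmp C (farr F f) (eta (f 1)))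
  (cmp C (eta (f 0)) (farr G f)) by [].
elim: gf => {f} [b p hp|p q gp IHp gq IHq pq|p q gp IHp pq].
- have gp := generated_in hp; split; [exact: hl | exact: hr | exact: nat hp].
- have gpq := generated_concat gp gq pq.
  have [b0 b1] := Bs p gp; have [b0' b1'] := Bs q gq.
  have aFp := aF p gp; have aGp := aG p gp; rewrite pq in aFp aGp IHp.
  have ps := paste_squares isC aFp (aF q gq) (ae _ b0') (ae _ b1') (ae _ b0)
    aGp (aG q gq) IHp IHq.
  have [hp hq] := (generated_hom gp, generated_hom gq).
  have eF : heq (C := C) (farr F (concat p q)) (cmp C (farr F p) (farr F q)).
    split; [by case: (aF _ gpq) | by case: (is_arr_cmp isC aFp (aF q gq)) |].
    exact: iF.2.2.2.2.
  have eG : heq (C := C) (farr G (concat p q)) (cmp C (farr G p) (farr G q)).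
    split; [by case: (aG _ gpq) | by case: (is_arr_cmp isC aGp (aG q gq)) |].
    exact: iG.2.2.2.2.
  rewrite concat0 concat1.
  have r x : setU2 B x -> heq (C := C) (eta x) (eta x).
    by move=> Bx; apply: heq_refl => //; case: (ae x Bx).
  apply: (heq_trans isC (heq_cmp isC eF (r _ b1') _)).
    by have [_ _ ->] := aF _ gpq; have [_ -> _] := ae _ b1'; rewrite concat1.
  apply: (heq_trans isC ps); apply: (heq_sym isC).
  apply: (heq_cmp isC (r _ b0) eG).
  by have [_ -> _] := aG _ gpq; have [_ _ ->] := ae _ b0; rewrite concat0.
- have gq := generated_dieq gp pq; have [e0 e1] := dieq_ends pq.
  have [hp hq] := (generated_hom gp, generated_hom gq).
  have [b0 b1] := Bs p gp; rewrite -e0 -e1.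
  have r x : setU2 B x -> heq (C := C) (eta x) (eta x).
    by move=> Bx; apply: heq_refl => //; case: (ae x Bx).
  have eF : heq (C := C) (farr F q) (farr F p).
    split; [by case: (aF q gq) | by case: (aF p gp) | apply: iF.2.2.1 => //].
    exact: dieq_sym.
  have eG : heq (C := C) (farr G q) (farr G p).
    split; [by case: (aG q gq) | by case: (aG p gp) | apply: iG.2.2.1 => //].
    exact: dieq_sym.
  apply: (heq_trans isC (heq_cmp isC eF (r _ b1) _)).
    by have [_ _ ->] := aF q gq; have [_ -> _] := ae _ b1; rewrite e1.
  apply: (heq_trans isC IHp); apply: (heq_sym isC).
  apply: (heq_cmp isC (r _ b0) eG).
  by have [_ -> _] := aG q gq; have [_ _ ->] := ae _ b0; rewrite e0.
Qed.

(** * From one level of the chains to the next *)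

Section Step.
Context (B0 A0 : set X) (B A : bool -> set X) (fut : bool).
Hypotheses (B0E : B0 = B true `&` B false) (A0E : A0 = A true `&` A false).
Hypotheses (AB : forall b, A b `<=` B b) (BY : forall b, B b `<=` Y b).
Context (P0 : functor (pi1 D Y0 B0) (pi1 D Y0 A0)).
Context (P : forall b, functor (pi1 D (Y b) (B b)) (pi1 D (Y b) (A b))).
Context (eta0 : X -> R -> X) (eta : bool -> X -> R -> X).
Hypothesis isP0 : IsFunctor P0.
Hypothesis isP : forall b, is_retract fut (P b) (eta b).
Hypothesis P_ob : forall b x, B0 x -> fob (P b) x = fob P0 x.
Hypothesis P_arr : forall b p, hom (pi1 D Y0 B0) p ->
  dieq D (Y b) (farr (P b) p) (farr P0 p).
Hypothesis eta_eq : forall b x, B0 x -> dieq D (Y b) (eta0 x) (eta b x).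
Hypotheses (poB : pushout_at B0 B) (genB : generating B).

Let iP b : IsFunctor (P b). Proof. by case: (isP b). Qed.

Let AUBU : setU2 A `<=` setU2 B.
Proof. by move=> x [] /AB ?; [left | right]. Qed.

Let CA : IsCat (pi1 D setT (setU2 A)). Proof. exact: pi1_IsCat. Qed.
Let CB : IsCat (pi1 D setT (setU2 B)). Proof. exact: pi1_IsCat. Qed.
Let CAb b : IsCat (pi1 D (Y b) (A b)).
Proof. by apply: pi1_IsCat => x /AB /BY. Qed.
Let CBb b : IsCat (pi1 D (Y b) (B b)). Proof. exact: pi1_IsCat (@BY b). Qed.

Let Y0Y b : Y0 `<=` Y b. Proof. by rewrite Y0E; case: b => x []. Qed.
Let A0A b : A0 `<=` A b. Proof. by rewrite A0E; case: b => x []. Qed.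

Let jA b : IsFunctor (jincl A b).
Proof. by apply: pincl_IsFunctor => //; exact: setU2_in. Qed.

Lemma glued_functor : exists Pl : functor (pi1 D setT (setU2 B)) (pi1 D setT (setU2 A)),
  [/\ IsFunctor Pl,
      forall b, feq (fcomp (jincl B b) Pl) (fcomp (P b) (jincl A b)) &
      forall Pl' : functor (pi1 D setT (setU2 B)) (pi1 D setT (setU2 A)),
        IsFunctor Pl' ->
        (forall b, feq (fcomp (jincl B b) Pl') (fcomp (P b) (jincl A b))) -> feq Pl' Pl].
Proof.
apply: (poB (G := fun b => fcomp (P b) (jincl A b))) => //.
- by move=> b; apply: fcomp_IsFunctor.
- by move=> x B0x /=; rewrite !P_ob.
- move=> p hp /=; apply: (@dieq_trans _ _ D setT _ (farr P0 p)).
    by apply: dieq_sub (P_arr true hp).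
  by apply/dieq_sym; apply: dieq_sub (P_arr false hp).
Qed.

Section Glued.
Context (Pl : functor (pi1 D setT (setU2 B)) (pi1 D setT (setU2 A))).
Hypothesis isPl : IsFunctor Pl.
Hypothesis PlE : forall b, feq (fcomp (jincl B b) Pl) (fcomp (P b) (jincl A b)).

Definition glue_unit x : R -> X :=
  if `[< B true x >] then eta true x else eta false x.

Lemma glue_unitE b x : B b x -> dieq D setT (glue_unit x) (eta b x).
Proof.
rewrite /glue_unit; case: asboolP => B1; case: b => // B2; try exact: dieq_refl.
have B0x : B0 x by rewrite B0E.
apply: (@dieq_trans _ _ D setT _ (eta0 x)).
  by apply/dieq_sym; apply: dieq_sub (eta_eq true B0x).
by apply: dieq_sub (eta_eq false B0x).
Qed.

Let setU2P x : setU2 B x -> exists b, B b x.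
Proof. by case=> ?; [exists true | exists false]. Qed.

Lemma lower_fun_glue f b p : hom (pi1 D (Y b) (B b)) p ->
  dieq D setT (farr (lower_fun f Pl) p) (farr (lower_fun f (P b)) p).
Proof.
by move=> hp; case: f => /=; [exact: dieq_refl | exact: (PlE b).2].
Qed.

Lemma lower_fun_glue_ob f b x : B b x ->
  fob (lower_fun f Pl) x = fob (lower_fun f (P b)) x.
Proof. by move=> Bx; case: f => //=; exact: (PlE b).1. Qed.

Lemma glued_is_retract : is_retract fut Pl glue_unit.
Proof.
have iL f : IsFunctor (lower_fun f Pl) by exact: lower_fun_IsFunctor.
have hunit x : setU2 B x -> hom (pi1 D setT (setU2 B)) (glue_unit x) /\
    glue_unit x 0 = fob (lower_fun fut Pl) x /\
    glue_unit x 1 = fob (lower_fun (~~ fut) Pl) x.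
  move=> /setU2P[b Bx]; have ge := glue_unitE Bx; have [e0 e1] := dieq_ends ge.
  have [_ [hn _] _ _] := isP b; have [h [s t]] := hn x Bx.
  rewrite /= in s t; rewrite e0 e1 !(lower_fun_glue_ob _ Bx) s t; split=> //.
  exact: hom_dieq (dieq_sym ge) (hom_setU2 h).
split=> //.
- apply: IsNat_generated => // b p hp; have [dp [p0 p1]] := hp.
  have hpU := hom_setU2 hp.
  have [_ [_ nat] _ _] := isP b.
  have [h1 [s1 t1]] := (iL fut).2.1 p hpU; have [h2 [s2 t2]] := (iL (~~ fut)).2.1 p hpU.
  have [hu0 [us0 ut0]] := hunit _ hpU.2.1; have [hu1 [us1 ut1]] := hunit _ hpU.2.2.
  rewrite /= in s1 t1 s2 t2.
  have e1 := lower_fun_glue fut hp; have e2 := lower_fun_glue (~~ fut) hp.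
  have g0 := glue_unitE p0; have g1 := glue_unitE p1.
  apply: (dieq_trans (dieq_concat _ hu1.1 e1 g1 _)).
  + exact/(dieq_dipath e1).1/h1.1.
  + by rewrite t1 us1.
  apply: (dieq_trans (dieq_sub (@subsetT _ _) (nat p hp))).
  apply/dieq_sym; apply: (dieq_concat _ h2.1 g0 e2).
  + exact/(dieq_dipath g0).1/hu0.1.
  + by rewrite s2 ut0.
- move=> a aA; have [b Aa] : exists b, A b a.
    by case: aA => ?; [exists true | exists false].
  have [_ _ he _] := isP b.
  by apply: dieq_trans (glue_unitE (AB Aa)) _; apply: dieq_sub (he a Aa).
- move=> x Bx; have [hu _] := hunit x Bx; have [b Bbx] := setU2P Bx.
  have [_ [hn _] _ he] := isP b; have [h _] := hn x Bbx.
  apply: (dieq_trans (isPl.2.2.1 _ _ hu (hom_setU2 h) (glue_unitE Bbx))).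
  apply: (dieq_trans ((PlE b).2 _ h)).
  by have := (PlE b).1 x Bbx => /= ->; apply: dieq_sub (he x Bbx).
Qed.

(** A path of the lower level equals its image under [Pl]. Decomposed at the upper level and mapped
    by [Pl], each of its pieces becomes a path of the lower level inside one part. *)
Lemma step_generating : generating A.
Proof.
move=> p hp.
have Plp : dieq D setT (farr Pl p) p.
  exact: (retract_arr AUBU (@subsetT _ _) glued_is_retract).
apply: generated_dieq Plp.
have : generated B p.
  by apply: genB; case: hp => dp [p0 p1]; split=> //; split; exact: AUBU.
elim=> {p hp} [b p hp|p q gp IHp gq IHq pq|p q gp IHp pq].
- apply: (@generated_dieq _ (farr (P b) p)).
    by apply: (@generated_in _ b); case: ((iP b).2.1 p hp).
  exact/dieq_sym/(PlE b).2.
- have hp := generated_hom gp; have hq := generated_hom gq.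
  have [_ [_ t]] := isPl.2.1 p hp; have [_ [s _]] := isPl.2.1 q hq.
  apply: (@generated_dieq _ (concat (farr Pl p) (farr Pl q))).
    by apply: generated_concat => //; rewrite /= in s t; rewrite s t pq.
  by apply/dieq_sym; exact: isPl.2.2.2.2.
- apply: generated_dieq IHp _.
  by apply: isPl.2.2.1 => //; [exact: generated_hom |
    exact/generated_hom/(generated_dieq gp)].
Qed.

Lemma step_pushout : pushout_at A0 A.
Proof.
move=> E G isE isG Gob Garr.
pose GP b := fcomp (P b) (G b).
have iGP b : IsFunctor (GP b) by exact: fcomp_IsFunctor.
have hP0 p : hom (pi1 D Y0 B0) p -> forall b, hom (pi1 D (Y b) (A b)) (farr P0 p).
  move=> hp b; have [[dp [p0 p1]] _] := isP0.2.1 p hp.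
  by split; [exact: dipath_sub (@Y0Y b) dp | split; exact: (@A0A b)].
have hB0 p b : hom (pi1 D Y0 B0) p -> hom (pi1 D (Y b) (B b)) p.
  move=> [dp [p0 p1]]; split; first exact: dipath_sub (@Y0Y b) dp.
  by move: p0 p1; rewrite B0E; case: (b) => -[? ?] [? ?].
(* On the intersection both composites factor through [P0], whose values lie at the level where
   [G true] and [G false] are assumed to agree. *)
have eqG b p : hom (pi1 D Y0 B0) p -> heq (farr (GP b) p) (farr (G b) (farr P0 p)).
  move=> hp; have [h1 _] := (iP b).2.1 p (hB0 p b hp); have h2 := hP0 p hp b.
  split; [by case: ((isG b).2.1 _ h1) | by case: ((isG b).2.1 _ h2) |].
  by apply: (isG b).2.2.1 => //; exact: P_arr.
have [||H [iH HG Hu]] := poB isE iGP.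
- by move=> x B0x; rewrite /= !P_ob //; apply: Gob; apply: isP0.1.
- move=> p hp.
  suff [] : heq (farr (GP true) p) (farr (GP false) p) by [].
  apply: (heq_trans isE (eqG true p hp)).
  apply: (heq_trans isE _ (heq_sym isE (eqG false p hp))).
  have hh b := (isG b).2.1 _ (hP0 p hp b).
  split; [by case: (hh true) | by case: (hh false) |].
  by apply: Garr; case: (isP0.2.1 p hp).
have iI : IsFunctor (pincl D setT (setU2 A) setT (setU2 B)) by exact: pincl_IsFunctor.
have retPl := glued_is_retract.
have homAB p : hom (pi1 D setT (setU2 A)) p -> hom (pi1 D setT (setU2 B)) p.
  by case=> dp [p0 p1]; split=> //; split; exact: AUBU.
have homABb b p : hom (pi1 D (Y b) (A b)) p -> hom (pi1 D (Y b) (B b)) p.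
  by case=> dp [p0 p1]; split=> //; split; exact: AB.
exists (fcomp (pincl D setT (setU2 A) setT (setU2 B)) H); split.
- exact: fcomp_IsFunctor.
- move=> b; split=> [x Ax|p hp] /=.
    have := (HG b).1 x (AB Ax) => /= ->.
    by rewrite (retract_ob (@AB b) (isP b) Ax).
  have hpB := homABb b p hp.
  have [h1 _] := (iP b).2.1 p hpB.
  suff [] : heq (farr H p) (farr (G b) p) by [].
  apply: (@heq_trans _ isE _ (farr (G b) (farr (P b) p))).
    split; [by case: (iH.2.1 p (hom_setU2 hpB)) | by case: ((isG b).2.1 _ h1) |].
    exact: (HG b).2.
  split; [by case: ((isG b).2.1 _ h1) | by case: ((isG b).2.1 _ hp) |].
  apply: (isG b).2.2.1 => //.
  exact: (retract_arr (@AB b) (@BY b) (isP b)).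
move=> H' iH' H'G.
have [] : feq (fcomp Pl H') H.
  apply: Hu => [|b]; first exact: fcomp_IsFunctor.
  split=> [x Bx|p hp] /=.
    have := (PlE b).1 x Bx => /= ->; apply: (H'G b).1.
    exact: (iP b).1.
  have [h1 _] := (iP b).2.1 p hp; have [h2 _] := isPl.2.1 p (hom_setU2 hp).
  suff [] : heq (farr H' (farr Pl p)) (farr (G b) (farr (P b) p)) by [].
  apply: (@heq_trans _ isE _ (farr H' (farr (P b) p))).
    split; [by case: (iH'.2.1 _ h2) | by case: (iH'.2.1 _ (hom_setU2 h1)) |].
    apply: iH'.2.2.1 => //; [exact: hom_setU2 h1 | exact: (PlE b).2].
  split; [by case: (iH'.2.1 _ (hom_setU2 h1)) | by case: ((isG b).2.1 _ h1) |].
  exact: (H'G b).2.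
move=> eo ea; split=> [x Ax|p hp] /=.
  by rewrite -(eo x (AUBU Ax)) /= (retract_ob AUBU retPl Ax).
have hpB := homAB p hp; have [h1 _] := isPl.2.1 p hpB.
suff [] : heq (farr H' p) (farr H p) by [].
apply: (@heq_trans _ isE _ (farr H' (farr Pl p))).
  split; [by case: (iH'.2.1 _ hp) | by case: (iH'.2.1 _ h1) |].
  apply: iH'.2.2.1 => //; apply/dieq_sym.
  exact: (retract_arr AUBU (@subsetT _ _) retPl).
split; [by case: (iH'.2.1 _ h1) | by case: (iH.2.1 _ hpB) | exact: ea].
Qed.

End Glued.
End Step.

Lemma pushout_at_IsPushout (B0 : set X) (B : bool -> set X) :
  pushout_at B0 B ->
  IsPushout (pincl D Y0 B0 (Y true) (B true)) (pincl D Y0 B0 (Y false) (B false))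
            (jincl B true) (jincl B false).
Proof.
move=> po; split.
  by split=> // p _; exact: dieq_refl.
move=> E G1 G2 isE i1 i2 [eo ea].
pose G b := match b return functor (pi1 D (Y b) (B b)) E with true => G1 | false => G2 end.
have iG b : IsFunctor (G b) by case: b.
have [H [iH HG Hu]] := po E G isE iG eo ea.
exists H; split=> //; split; first exact: (HG true).
split; first exact: (HG false).
by move=> H' iH' h1 h2; apply: Hu => // -[].
Qed.

(** * Level zero *)

Section Base.
Hypothesis Ycover : forall x, exists b, interior (Y b) x.

Lemma van_kampen : pushout_at Y0 Y.
Proof.
move=> E G isE isG Gob Garr.
have AT x : setU2 Y x.
  by have [b /interior_subset Yx] := Ycover x; exact: (@setU2_in Y b).
apply: (van_kampen_functor Ycover isE isG) => //.
  by move=> x Y1 Y2; apply: Gob; rewrite Y0E.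
move=> p d1 d2; apply: Garr.
have d0 : dipath_in D Y0 p.
  by split; [exact: d1.1 | move=> t t01; rewrite Y0E; split; [exact: d1.2 | exact: d2.2]].
by split=> //; split; apply: d0.2.
Qed.

Lemma base_generating : generating Y.
Proof.
move=> p [[dp _] _]; move: p dp; apply: (dpath_ind Ycover) => [b p dp|p dp g0 g1].
  by apply: (@generated_in _ b); split=> //; split; exact: dp.2.
by rewrite -(concat_halves p); apply: generated_concat => //; rewrite half10.
Qed.

End Base.
End Pushouts.

(** * Induction along the chains *)

Unset Implicit Arguments. Set Strict Implicit.

(* Y k l = X_{k,l} for k = 0,1,2 and l = 0..n (Y k 0 = X_k);
   P k l = P_{k,l}, with unit eta k l and counit eps k l;
   fut l = true iff the P_{k,l} are future retracts. *)
Theorem theorem4p8 (R : realType) (X : topologicalType) (D : dspace R X)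
    (n : nat) (Y : nat -> nat -> set X)
    (P : forall k l : nat,
       functor (pi1 D (Y k 0%N) (Y k l.-1)) (pi1 D (Y k 0%N) (Y k l)))
    (eta eps : nat -> nat -> X -> R -> X) (fut : nat -> bool) :
  (* X = Int X_1 ∪ Int X_2 *)
  setT = interior (Y 1%N 0%N) `|` interior (Y 2%N 0%N) ->
  (* dipaths of X are finite concatenations of dipaths of X_1 and X_2 *)
  (forall p, dpath D p ->
     exists (m : nat) (t : nat -> R),
       t 0%N = 0 /\ t m = 1 /\ (forall i, (i < m)%N -> t i <= t i.+1) /\
       forall i, (i < m)%N ->
         (forall u, t i <= u <= t i.+1 -> Y 1%N 0%N (p u)) \/
         (forall u, t i <= u <= t i.+1 -> Y 2%N 0%N (p u))) ->
  (* X_{0,l} = X_{1,l} ∩ X_{2,l}  (in particular X_0 = X_1 ∩ X_2) *)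
  (forall l, (l <= n)%N -> Y 0%N l = Y 1%N l `&` Y 2%N l) ->
  (* the chains X_k = X_{k,0} ⊇ X_{k,1} ⊇ ... ⊇ X_{k,n} *)
  (forall k l, (k <= 2)%N -> (1 <= l <= n)%N -> Y k l `<=` Y k l.-1) ->
  (* each P_{k,l} is a future retract (with unit/counit eta, eps), resp. past *)
  (forall k l, (k <= 2)%N -> (1 <= l <= n)%N ->
     if fut l
     then future_retract (P k l) (eta k l) (eps k l)
     else past_retract (P k l) (eta k l) (eps k l)) ->
  (* X_l = Int_{X_l}(X_{1,l}) ∪ Int_{X_l}(X_{2,l}) *)
  (forall l, (1 <= l <= n)%N ->
     Y 1%N l `|` Y 2%N l =
       relint (Y 1%N l `|` Y 2%N l) (Y 1%N l) `|`
       relint (Y 1%N l `|` Y 2%N l) (Y 2%N l)) ->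
  (* P_{k,l} o i_{k,l-1} = i_{k,l} o P_{0,l} *)
  (forall k l, (1 <= k <= 2)%N -> (1 <= l <= n)%N ->
     feq (fcomp (pincl D (Y 0%N 0%N) (Y 0%N l.-1) (Y k 0%N) (Y k l.-1)) (P k l))
         (fcomp (P 0%N l) (pincl D (Y 0%N 0%N) (Y 0%N l) (Y k 0%N) (Y k l)))) ->
  (* units (resp. counits) of P_{0,l} map to those of P_{k,l} *)
  (forall k l, (1 <= k <= 2)%N -> (1 <= l <= n)%N ->
     forall x, Y 0%N l.-1 x ->
       if fut l
       then aeq (pi1 D (Y k 0%N) (Y k l.-1)) (eta 0%N l x) (eta k l x)
       else aeq (pi1 D (Y k 0%N) (Y k l.-1)) (eps 0%N l x) (eps k l x)) ->
  (* conclusion 1: the squares are pushouts of categories *)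
  (forall l, (l <= n)%N ->
     IsPushout
       (pincl D (Y 0%N 0%N) (Y 0%N l) (Y 1%N 0%N) (Y 1%N l))
       (pincl D (Y 0%N 0%N) (Y 0%N l) (Y 2%N 0%N) (Y 2%N l))
       (pincl D (Y 1%N 0%N) (Y 1%N l) setT (Y 1%N l `|` Y 2%N l))
       (pincl D (Y 2%N 0%N) (Y 2%N l) setT (Y 1%N l `|` Y 2%N l))) /\
  (* conclusion 2: unique induced P_l, which is a future / past retract *)
  (forall l, (1 <= l <= n)%N ->
     exists Pl : functor (pi1 D setT (Y 1%N l.-1 `|` Y 2%N l.-1))
                         (pi1 D setT (Y 1%N l `|` Y 2%N l)),
       IsFunctor Pl /\
       (forall k, (1 <= k <= 2)%N ->
          feq (fcomp (pincl D (Y k 0%N) (Y k l.-1) setT (Y 1%N l.-1 `|` Y 2%N l.-1)) Pl)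
              (fcomp (P k l) (pincl D (Y k 0%N) (Y k l) setT (Y 1%N l `|` Y 2%N l)))) /\
       (forall Pl' : functor (pi1 D setT (Y 1%N l.-1 `|` Y 2%N l.-1))
                             (pi1 D setT (Y 1%N l `|` Y 2%N l)),
          IsFunctor Pl' ->
          (forall k, (1 <= k <= 2)%N ->
             feq (fcomp (pincl D (Y k 0%N) (Y k l.-1) setT (Y 1%N l.-1 `|` Y 2%N l.-1)) Pl')
                 (fcomp (P k l) (pincl D (Y k 0%N) (Y k l) setT (Y 1%N l `|` Y 2%N l)))) ->
          feq Pl' Pl) /\
       exists etal epsl : X -> R -> X,
         if fut l then future_retract Pl etal epsl else past_retract Pl etal epsl).
Proof.
move=> Xint _ Y0E Ysub Pret _ Pcomp etacomp.
pose kk (b : bool) : nat := if b then 1%N else 2%N.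
have kk2 b : (kk b <= 2)%N by case: b.
have kk12 b : (1 <= kk b <= 2)%N by case: b.
have kkE k : (1 <= k <= 2)%N -> exists b, k = kk b.
  by case: k => [|[|[|k]]] // _; [exists true | exists false].
pose Yb b := Y (kk b) 0%N; pose Yl l b := Y (kk b) l.
have Ycover x : exists b, interior (Yb b) x.
  have : [set: X] x by []; rewrite Xint => -[Yx|Yx]; first by exists true.
  by exists false.
have Y00 : Y 0%N 0%N = Yb true `&` Yb false by exact: Y0E.
have Ysub0 k l : (k <= 2)%N -> (l <= n)%N -> Y k l `<=` Y k 0%N.
  move=> k2; elim: l => [|l IH] ln; first by [].
  by move=> x /(Ysub k l.+1 k2 ln); apply: IH; exact: ltnW.
(* The transformation that [is_retract] records: the unit at a future step, the counit at a past
   step. *)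
pose unit k l := if fut l then eta k l else eps k l.
have Pis k l : (k <= 2)%N -> (1 <= l <= n)%N -> is_retract (fut l) (P k l) (unit k l).
  move=> k2 l1n; have AB := Ysub k l k2 l1n.
  have BY : Y k l.-1 `<=` Y k 0%N.
    by apply: Ysub0 => //; case/andP: l1n => _; apply: leq_trans; exact: leq_pred.
  have := Pret k l k2 l1n; rewrite /unit; case: (fut l).
    exact: future_retract_is_retract.
  exact: past_retract_is_retract.
have step l : (1 <= l <= n)%N ->
    pushout_at D (Y 0%N 0%N) Yb (Y 0%N l.-1) (Yl l.-1) ->
    generating D Yb (Yl l.-1) ->
    [/\ exists Pl : functor (pi1 D setT (setU2 (Yl l.-1))) (pi1 D setT (setU2 (Yl l))),
          [/\ IsFunctor Pl,
              forall b, feq (fcomp (jincl D Yb (Yl l.-1) b) Pl)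
                            (fcomp (P (kk b) l) (jincl D Yb (Yl l) b)),
              forall Pl' : functor (pi1 D setT (setU2 (Yl l.-1)))
                                   (pi1 D setT (setU2 (Yl l))),
                IsFunctor Pl' ->
                (forall b, feq (fcomp (jincl D Yb (Yl l.-1) b) Pl')
                               (fcomp (P (kk b) l) (jincl D Yb (Yl l) b))) ->
                feq Pl' Pl &
              exists u, is_retract (fut l) Pl u],
        pushout_at D (Y 0%N 0%N) Yb (Y 0%N l) (Yl l) & generating D Yb (Yl l)].
  move=> l1n po gen; have /andP[l1 ln] := l1n.
  have ln' : (l.-1 <= n)%N by apply: leq_trans ln; exact: leq_pred.
  have B0E : Y 0%N l.-1 = Yl l.-1 true `&` Yl l.-1 false by exact: Y0E.
  have A0E : Y 0%N l = Yl l true `&` Yl l false by exact: Y0E.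
  have AB b : Yl l b `<=` Yl l.-1 b by apply: Ysub.
  have BY b : Yl l.-1 b `<=` Yb b by apply: Ysub0.
  have iP0 : IsFunctor (P 0%N l) by case: (Pis 0%N l isT l1n).
  have isP b : is_retract (fut l) (P (kk b) l) (unit (kk b) l) by apply: Pis.
  have Pob b := (Pcomp (kk b) l (kk12 b) l1n).1.
  have Parr b := (Pcomp (kk b) l (kk12 b) l1n).2.
  have ue b x : Y 0%N l.-1 x -> dieq D (Yb b) (unit 0%N l x) (unit (kk b) l x).
    by move=> /(etacomp (kk b) l (kk12 b) l1n); rewrite /unit; case: (fut l).
  have [Pl [iPl PlE Plu]] := glued_functor AB BY isP Pob Parr po.
  have ret := glued_is_retract B0E AB isP ue gen iPl PlE.
  split.
  - by exists Pl; split=> //; eexists; exact: ret.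
  - exact: (step_pushout Y00 B0E A0E AB BY iP0 isP Pob Parr ue po gen iPl PlE).
  - exact: (step_generating B0E AB isP ue gen iPl PlE).
(* At level zero the object sets are the full pieces, and both properties come from subdividing
   paths. *)
have all l : (l <= n)%N -> pushout_at D (Y 0%N 0%N) Yb (Y 0%N l) (Yl l) /\
    generating D Yb (Yl l).
  elim: l => [_|l IH ln]; first by split; [exact: van_kampen | exact: base_generating].
  have [po gen] := IH (ltnW ln).
  by have [] := step l.+1 ln po gen.
split=> [l /all[po _]|l l1n].
  exact: (pushout_at_IsPushout po).
have /all[po gen] : (l.-1 <= n)%N.
  by case/andP: l1n => _; apply: leq_trans; exact: leq_pred.
have [[Pl [iPl PlE Plu [u ret]]] _ _] := step l l1n po gen.
exists Pl; split=> //; split; first by move=> k /kkE[b ->]; exact: PlE.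
split; first by move=> Pl' iPl' h; apply: Plu => // b; exact: h.
have AB : setU2 (Yl l) `<=` setU2 (Yl l.-1).
  by move=> x [] /Ysub h; [left | right]; exact: h.
exact: (is_retract_adjunction AB (@subsetT _ _) ret).
Qed.
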